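(* Let $(X,\mu,T)$ be a measure-preserving system. Then there exists a function $\Phi:\mathbb{N}\times(0,\infty)\to[0,\infty)$ such that $\Phi(n,\varepsilon)$ is increasing in $n$, decreasing in $\varepsilon$, subadditive (i.e. $\Phi(k+m,\varepsilon)\le\Phi(k,\varepsilon)+\Phi(m,\varepsilon)$ for all $\varepsilon>0$ and $k,m\in\mathbb{N}$), and $$\Phi\in\mathcal{H}(X,\mu,T),$$ where $\mathcal{H}(X,\mu,T)$ is the scaling entropy of the system.
   Context: A measure-preserving system $(X,\mu,T)$ is a standard probability space $(X,\mu)$ with an invertible measure-preserving transformation $T$. Increasing and decreasing are meant in the non-strict sense; $\mathbb{N}=\{1,2,\dots\}$. A measurable semimetric on $(X,\mu)$ is a symmetric non-negative measurable function $\rho$ on $(X^2,\mu^2)$ satisfying the triangle inequality. $\varepsilon$-entropy: for $\varepsilon>0$, let $k$ be the minimal positive integer such that $X$ decomposes into a union of measurable sets $X_0,X_1,\dots,X_k$ with $\mu(X_0)<\varepsilon$ and $\operatorname{diam}_\rho(X_i)<\varepsilon$ for all $i>0$; put $\mathbb{H}_\varepsilon(X,\mu,\rho)=\log_2 k$, and $\mathbb{H}_\varepsilon(X,\mu,\rho)=+\infty$ if no such $k$ exists. A semimetric $\rho$ is admissible if $\mathbb{H}_\varepsilon(X,\mu,\rho)<+\infty$ for all $\varepsilon>0$. Averaged semimetric: $T_{av}^n\rho(x,y)=\frac1n\sum_{k=0}^{n-1}\rho(T^kx,T^ky)$. A semimetric $\rho$ is generating (for $T$) if there is a set $X'\subset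 X$ of full measure such that for any distinct $x,y\in X'$ there is $n\in\mathbb{N}$ with $T_{av}^n\rho(x,y)>0$. For sequences $\phi,\psi$ of non-negative reals, $\phi\lesssim\psi$ means there is $C>0$ with $\phi(n)\le C\psi(n)$ for all $n\in\mathbb{N}$. For functions $\Phi,\Psi:\mathbb{N}\times(0,\infty)\to[0,\infty)$ decreasing in their second argument, write $\Phi\preceq\Psi$ if for every $\varepsilon>0$ there is $\delta>0$ such that $\Phi(n,\varepsilon)\lesssim\Psi(n,\delta)$ (as sequences in $n$), and $\Phi\sim\Psi$ if $\Phi\preceq\Psi$ and $\Psi\preceq\Phi$; $[\Phi]$ denotes the equivalence class of $\Phi$ under $\sim$. The scaling entropy of $(X,\mu,T)$ is the class $\mathcal{H}(X,\mu,T)=[\,(n,\varepsilon)\mapsto\mathbb{H}_\varepsilon(X,\mu,T_{av}^n\rho)\,]$, where $\rho$ is any admissible generating semimetric with finite integral over $(X^2,\mu^2)$; this class does not depend on the choice of $\rho$. *)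

(* Defs.v *)
From HB Require Import structures.
From mathcomp Require Import all_boot all_order all_algebra.
From mathcomp Require Import all_classical all_reals all_analysis.

Set Implicit Arguments.
Unset Strict Implicit.
Unset Printing Implicit Defensive.
Import Order.TTheory GRing.Theory Num.Theory.
Import numFieldNormedType.Exports.
Local Open Scope classical_set_scope.
Local Open Scope ring_scope.

(* Isomorphism mod 0, in Rokhlin's sense, with a Borel probability measure on
   the line: f is injective on a set X1 of full measure, and it sends the
   measurable subsets of X1 to sets that are measurable for the completion of
   the image measure (squeezed between two Borel sets with a null difference).
   The sigma-algebra of X may be Borel or complete; atoms are allowed. *)
Definition standard_probability (R : realType) (d : measure_display)
    (X : measurableType d) (mu : probability X R) : Prop :=
  exists (X1 : set X) (f : X -> R),
    [/\ measurable X1, mu X1 = 1%E, measurable_fun setT f,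
        {in X1 &, injective f} &
        forall A : set X, measurable A -> A `<=` X1 ->
          exists B C : set R,
            [/\ measurable B, measurable C, B `<=` f @` A, f @` A `<=` C &
                mu (f @^-1` (C `\` B)) = 0%E]].

Definition invertible_measure_preserving (R : realType) (d : measure_display)
    (X : measurableType d) (mu : probability X R) (T : X -> X) : Prop :=
  [/\ measurable_fun setT T,
      exists S : X -> X, [/\ cancel T S, cancel S T & measurable_fun setT S] &
      forall A : set X, measurable A -> mu (T @^-1` A) = mu A].

(* No condition on rho x x is imposed; for an admissible rho it vanishes for
   almost every x, see decomposable below. *)
Definition measurable_semimetric (R : realType) (d : measure_display)
    (X : measurableType d) (rho : X -> X -> R) : Prop :=
  [/\ forall x y, 0 <= rho x y,
      forall x y, rho x y = rho y x,
      forall x y z, rho x z <= rho x y + rho y z &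
      measurable_fun setT (fun z : X * X => rho z.1 z.2)].

(* diam rho set0 is -oo rather than 0, which does not matter since diameters
   are only compared with positive numbers. *)
Definition diam (R : realType) (X : Type) (rho : X -> X -> R) (A : set X) :
    \bar R :=
  ereal_sup [set r | exists x y, [/\ A x, A y & r = (rho x y)%:E]].

(* The sets A 0, ..., A k may overlap or be empty; making them disjoint by
   successive differences preserves all the conditions. *)
Definition decomposable (R : realType) (d : measure_display)
    (X : measurableType d) (mu : probability X R) (rho : X -> X -> R)
    (eps : R) (k : nat) : Prop :=
  (0 < k)%N /\
  exists A : nat -> set X,
    [/\ forall i, (i <= k)%N -> measurable (A i),
        \bigcup_(i in [set i | (i <= k)%N]) A i = setT,
        (mu (A 0%N) < eps%:E)%E &
        forall i, (0 < i <= k)%N -> (diam rho (A i) < eps%:E)%E].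

Definition eps_entropy (R : realType) (d : measure_display)
    (X : measurableType d) (mu : probability X R) (rho : X -> X -> R)
    (eps : R) : \bar R :=
  match pselect (exists k : nat, `[< decomposable mu rho eps k >]) with
  | left ex_k => (ln (ex_minn ex_k)%:R / ln 2)%:E
  | right _ => +oo%E
  end.

Definition admissible (R : realType) (d : measure_display)
    (X : measurableType d) (mu : probability X R) (rho : X -> X -> R) : Prop :=
  forall eps : R, 0 < eps -> (eps_entropy mu rho eps < +oo)%E.

Definition averaged (R : realType) (X : Type) (T : X -> X)
    (rho : X -> X -> R) (n : nat) : X -> X -> R :=
  fun x y => n%:R^-1 * \sum_(k < n) rho (iter k T x) (iter k T y).

Definition generating (R : realType) (d : measure_display)
    (X : measurableType d) (mu : probability X R) (T : X -> X)
    (rho : X -> X -> R) : Prop :=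
  exists X' : set X,
    [/\ measurable X', mu X' = 1%E &
        forall x y, X' x -> X' y -> x <> y ->
          exists n : nat, (0 < n)%N /\ 0 < averaged T rho n x y].

(* Sequences are indexed by the positive integers: the value at 0 of a
   function on nat is ignored, and so are the values of a function of eps at
   nonpositive eps. The functions below take values in \bar R because
   eps_entropy does. *)
Definition seq_lesssim (R : realType) (phi psi : nat -> \bar R) : Prop :=
  exists C : R, 0 < C /\
    forall n : nat, (0 < n)%N -> (phi n <= C%:E * psi n)%E.

Definition scaling_le (R : realType) (Phi Psi : nat -> R -> \bar R) : Prop :=
  forall eps : R, 0 < eps -> exists delta : R, 0 < delta /\
    seq_lesssim (fun n => Phi n eps) (fun n => Psi n delta).

Definition scaling_equiv (R : realType) (Phi Psi : nat -> R -> \bar R) : Prop :=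
  scaling_le Phi Psi /\ scaling_le Psi Phi.

Definition scaling_semimetric (R : realType) (d : measure_display)
    (X : measurableType d) (mu : probability X R) (T : X -> X)
    (rho : X -> X -> R) : Prop :=
  [/\ measurable_semimetric rho, admissible mu rho, generating mu T rho &
      (\int[(mu \x mu)%E]_z (rho z.1 z.2)%:E < +oo)%E].

(* The common equivalence class of the functions
   (n, eps) |-> eps_entropy mu (averaged T rho n) eps: a member is equivalent
   to the one given by every admissible generating integrable rho, and such
   rho exist. *)
Definition scaling_entropy (R : realType) (d : measure_display)
    (X : measurableType d) (mu : probability X R) (T : X -> X) :
    set (nat -> R -> R) :=
  [set Phi | (forall n eps, (0 < n)%N -> 0 < eps -> 0 <= Phi n eps) /\
     (forall n eps1 eps2, (0 < n)%N -> 0 < eps1 -> eps1 <= eps2 ->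
        Phi n eps2 <= Phi n eps1) /\
     (exists rho, scaling_semimetric mu T rho) /\
     forall rho, scaling_semimetric mu T rho ->
       scaling_equiv (fun n eps => (Phi n eps)%:E)
         (fun n eps => eps_entropy mu (averaged T rho n) eps)].

(* Main.v *)
(* Fix a bounded function g on X, injective on a set of full measure.  Let
   K(n, e) be the least k such that the map x |-> (g (T^j x))_(j < n) is
   e-approximable, in L^1(mu) for the normalized l^1 norm on R^n, by a map to
   R^n with k values.  Because the approximating values are not required to come
   from points of X, concatenating codes gives exactly
   K(a + b, e) <= K(a, e) K(b, e); and
   Phi(n, e) = log_2 inf_(m >= n) K(m, e) is moreover increasing in n.  Passing
   from m to n <= m costs only a factor 2 in e, as some window of length n is
   coded well.
   That Phi is equivalent to the entropy of every admissible generating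
   integrable rho rests on two comparisons, valid for every e > 0 with some
   finite N, L and some u >= 0 of integral at most e:
     rho(x, y) <= e + L |g x - g y| + u x + u y,
     |g x - g y| <= e + L \sum_(i < N) rho(T^i x, T^i y) + u x + u y;
   the first is a Lusin-type statement, and the second follows from it by a
   compactness argument, rho being generating.  In the second, averaging over n
   leaves boundary terms that are negligible only for large n: a decomposition
   for the n-average is therefore first turned into a code of length p n, with
   p fixed, which costs the factor p in the entropy. *)

Require Import Defs.
From HB Require Import structures.
From mathcomp Require Import all_boot all_order all_algebra.
From mathcomp Require Import all_classical all_reals all_analysis.
From mathcomp Require Import measurable_realfun.
From mathcomp Require Import ring lra.
Import Order.TTheory GRing.Theory Num.Theory.
Import numFieldNormedType.Exports.
Local Open Scope classical_set_scope.
Local Open Scope ring_scope.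

(** * Inner regularity and the coordinate of a standard space *)

Section small_sets.
Set Implicit Arguments.
Unset Strict Implicit.
Context {R : realType} {d : measure_display} {X : measurableType d}.
Context (mu : probability X R).

Lemma measure_setU_lt (A B : set X) (a b : R) : measurable A -> measurable B ->
  (mu A < a%:E)%E -> (mu B < b%:E)%E -> (mu (A `|` B) < (a + b)%:E)%E.
Proof.
move=> mA mB Aa Bb; apply: le_lt_trans (measureU2 mu mA mB) _.
by rewrite EFinD lteD.
Qed.

Lemma measure_bigcup_le (E : nat -> set X) (e : R) : 0 <= e ->
  (forall n, measurable (E n)) ->
  (forall n, (mu (E n) <= (e / (2 ^ n.+1)%:R)%:E)%E) ->
  (mu (\bigcup_n E n) <= e%:E)%E.
Proof.
move=> e0 mE Ee; apply: le_trans (epsilon_trick0 predT e0).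
apply: (@le_trans _ _ (\sum_(i <oo) mu (E i))%E).
  by apply: measure_sigma_subadditive => //; exact: bigcupT_measurable.
by apply: lee_nneseries => // i _; exact: Ee.
Qed.

Lemma measure_bigcup_ord_le (E : nat -> set X) (e : R) n :
  (forall i, (i < n)%N -> measurable (E i)) ->
  (forall i, (i < n)%N -> (mu (E i) <= e%:E)%E) ->
  (mu (\bigcup_(i in [set i | (i < n)%N]) E i) <= (n%:R * e)%:E)%E.
Proof.
elim: n => [|n IH] mE Ee.
  rewrite [X in mu X](_ : _ = set0) ?measure0 ?mul0r//.
  by apply/seteqP; split => // x [].
have -> : \bigcup_(i in [set i | (i < n.+1)%N]) E i =
    \bigcup_(i in [set i | (i < n)%N]) E i `|` E n.
  apply/seteqP; split => x.
    move=> [i /=]; rewrite ltnS leq_eqVlt => /orP[/eqP->|ni] Ex; first by right.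
    by left; exists i.
  by move=> [[i /= ni Ex]|Ex]; [exists i => //=; exact: ltnW|exists n => /=].
apply: le_trans (measureU2 _ _ _) _.
- by apply: bigcup_measurable => i /= ni; apply: mE; exact: ltnW.
- exact: mE.
rewrite -natr1 mulrDl mul1r EFinD leeD ?Ee// IH// => i ni.
  by apply: mE; exact: ltnW.
by apply: Ee; exact: ltnW.
Qed.

(** The n-th exceptional set is given measure below e / 2^(n+2); the union of all of them then has
    measure below [e] and, by monotonicity, serves every [P n] at once. *)
Lemma eventually_small (P : nat -> set X -> Prop) :
  (forall n E F, E `<=` F -> P n E -> P n F) ->
  (forall n (e : R), 0 < e -> exists E, [/\ measurable E, (mu E < e%:E)%E & P n E]) ->
  forall e : R, 0 < e ->
    exists E, [/\ measurable E, (mu E < e%:E)%E & forall n, P n E].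
Proof.
move=> Pmono Pex e e0.
have p n : 0 < e / 2 / (2 ^ n.+1)%:R :> R.
  by rewrite !divr_gt0// ltr0n expn_gt0.
have /choice[E HE] : forall n, exists E, [/\ measurable E,
    (mu E < (e / 2 / (2 ^ n.+1)%:R)%:E)%E & P n E] by move=> n; exact: Pex.
exists (\bigcup_n E n); split.
- by apply: bigcupT_measurable => n; have [] := HE n.
- apply: (@le_lt_trans _ _ (e / 2)%:E); last by rewrite lte_fin; lra.
  apply: measure_bigcup_le; [lra|by move=> n; have [] := HE n|].
  by move=> n; have [_ /ltW] := HE n.
- by move=> n; have [_ _] := HE n; apply: Pmono; exact: bigcup_sup.
Qed.

Lemma measurable_ge (f : X -> R) (a : R) : measurable_fun setT f ->
  measurable [set x | a <= f x].
Proof.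
move=> mf; rewrite -[X in measurable X]setTI.
have -> : [set x | a <= f x] = f @^-1` `[a, +oo[.
  by apply/seteqP; split => x /=; rewrite in_itv/= andbT.
by apply: mf => //; exact: measurable_itv.
Qed.

End small_sets.

Section inner_regularity.
Set Implicit Arguments.
Unset Strict Implicit.
Context {R : realType} {d : measure_display} {X : measurableType d}.
Context (mu : probability X R) (f : X -> R) (mf : measurable_fun setT f).

(** Inner regularity, at the set [B], of the image of [mu] under [f]. *)
Definition compact_regular (B : set R) := forall e : R, 0 < e ->
  exists K, [/\ compact K, K `<=` B & (mu (f @^-1` (B `\` K)) < e%:E)%E].

Let mpre (B : set R) : measurable B -> measurable (f @^-1` B).
Proof. by move=> mB; rewrite -[X in measurable X]setTI; exact: mf. Qed.

Let mcompact (K : set R) : compact K -> measurable K.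
Proof. by move=> /compact_closed cK; apply: closed_measurable; exact: cK. Qed.

Lemma nonincreasing_measure_lt (F : nat -> set X) (e : R) : 
  (forall n, measurable (F n)) -> nonincreasing_seq F ->
  (mu (\bigcap_n F n) < e%:E)%E -> exists n, (mu (F n) < e%:E)%E.
Proof.
move=> mF nF Fe.
have mI : measurable (\bigcap_n F n) by exact: bigcapT_measurable.
have F0 : (mu (F 0%N) < +oo)%E.
  by apply: le_lt_trans (ltry 1); exact: probability_le1.
have := @nonincreasing_cvg_mu _ _ _ mu F F0 mF mI nF.
move=> /(_ _ (open_ereal_lt' Fe)) [N _ HN]; exists N; exact: HN (leqnn N).
Qed.

Let itvE (a y : R) : `[- a, a]%classic y = (`|y| <= a) :> Prop.
Proof. by rewrite /= in_itv/= -ler_norml. Qed.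

(** Cutting by the segments [-n, n] leaves remainders whose preimages decrease to the empty set. *)
Lemma compact_regular_closed (F : set R) : closed F -> compact_regular F.
Proof.
move=> cF e e0.
pose G (n : nat) := f @^-1` (F `\` `[- n%:R, n%:R]).
have mG n : measurable (G n).
  apply: mpre; apply: measurableD; first exact: closed_measurable.
  exact: measurable_itv.
have [||n Gn] := @nonincreasing_measure_lt G e mG.
- move=> n m nm; apply/subsetPset => x [Fx h]; split => // xn; apply: h.
  move: xn; rewrite !itvE => /le_trans; apply; rewrite ler_nat//.
- rewrite (_ : \bigcap_n G n = set0) ?measure0//; apply/seteqP; split => // x H.
  have [_] := H (Num.truncn `|f x|).+1 I; rewrite itvE; apply; apply: ltW.
  exact: truncnS_gt.
exists (F `&` `[- n%:R, n%:R]); split.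
- by rewrite setIC; apply: compact_closedI => //; exact: segment_compact.
- by move=> x [].
- apply: le_lt_trans Gn; apply: le_measure; rewrite ?inE//.
    apply: mpre; apply: measurableD; first exact: closed_measurable.
    by apply: measurableI; [exact: closed_measurable|exact: measurable_itv].
  by move=> x [Fx h]; split => // K; apply: h.
Qed.

(** A countable union of compact sets need not be compact, so only a finite part [U n] is kept. All
    the approximation defects together cost e / 2, and continuity from above provides [n]. *)
Lemma compact_regular_bigcup (A : nat -> set R) : (forall n, measurable (A n)) ->
  (forall n, compact_regular (A n)) -> compact_regular (\bigcup_n A n).
Proof.
move=> mA rA e e0.
have p n : 0 < e / 2 / (2 ^ n.+1)%:R :> R.
  by rewrite !divr_gt0// ltr0n expn_gt0.
have /choice[K HK] := fun n => rA n _ (p n).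
have mK n : measurable (K n) by have [/mcompact] := HK n.
have mAK n : measurable (f @^-1` (A n `\` K n)).
  by apply: mpre; exact: measurableD.
pose U n := \big[setU/set0]_(i < n) K i.
have mU n : measurable (U n) by exact: bigsetU_measurable.
pose G n := f @^-1` (\bigcup_n A n `\` U n).
have mG n : measurable (G n).
  by apply: mpre; apply: measurableD => //; exact: bigcupT_measurable.
have [||n Gn] := @nonincreasing_measure_lt G e mG.
- move=> n m nm; apply/subsetPset => x [Ax] h; split => // U1; apply: h.
  move: U1; rewrite /U -!bigcup_mkord => -[i /= ni Ki]; exists i => //=.
  exact: leq_trans ni nm.
- apply: (@le_lt_trans _ _ (e / 2)%:E); last by rewrite lte_fin; lra.
  apply: (@le_trans _ _ (mu (\bigcup_n f @^-1` (A n `\` K n)))).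
    apply: le_measure; rewrite ?inE; [exact: bigcapT_measurable|
      exact: bigcupT_measurable|].
    move=> x H; have [[n _ An] _] := H 0%N I.
    exists n => //; split => // Kn; have [_] := H n.+1 I; apply.
    by rewrite /U -bigcup_mkord; exists n => /=.
  apply: measure_bigcup_le => //; first lra.
  by move=> n; have [_ _ /ltW] := HK n.
exists (U n); split => //.
- by apply: bigsetU_compact => i _; have [] := HK i.
- rewrite /U -bigcup_mkord => x [i _ Kx]; exists i => //.
  by have [_ + _] := HK i; exact.
Qed.

Lemma compact_regular_bigcap (A : nat -> set R) : (forall n, measurable (A n)) ->
  (forall n, compact_regular (A n)) -> compact_regular (\bigcap_n A n).
Proof.
move=> mA rA e e0.
have p n : 0 < e / 2 / (2 ^ n.+1)%:R :> R.
  by rewrite !divr_gt0// ltr0n expn_gt0.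
have /choice[K HK] := fun n => rA n _ (p n).
have mK n : measurable (K n) by have [/mcompact] := HK n.
have mAK n : measurable (f @^-1` (A n `\` K n)).
  by apply: mpre; exact: measurableD.
exists (\bigcap_n K n); split.
- apply: (@subclosed_compact _ _ (K 0%N)).
  + apply: closed_bigI => n _; have [cK _ _] := HK n.
    exact: compact_closed cK.
  + by have [] := HK 0%N.
  + exact: bigcap_inf.
- by move=> x H n _; have [_ + _] := HK n; apply; exact: H.
- apply: (@le_lt_trans _ _ (e / 2)%:E); last by rewrite lte_fin; lra.
  apply: (@le_trans _ _ (mu (\bigcup_n f @^-1` (A n `\` K n)))).
    apply: le_measure; rewrite ?inE; last first.
    + move=> x [/= H /existsNP[n /not_implyP[_ h]]]; exists n => //.
      by split => //; exact: H.
    + exact: bigcupT_measurable.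
    + by apply: mpre; apply: measurableD; exact: bigcapT_measurable.
  apply: measure_bigcup_le => //; first lra.
  by move=> n; have [_ _ /ltW] := HK n.
Qed.

(** The sets that are regular together with their complements form a sigma-algebra containing the
    open rays. Complements exchange unions and intersections, hence the two previous lemmas. *)
Lemma measurable_compact_regular (B : set R) : measurable B -> compact_regular B.
Proof.
move=> mB; suff [] : compact_regular B /\ compact_regular (~` B) by [].
pose D := [set B : set R | measurable B /\ compact_regular B /\ compact_regular (~` B)].
suff sD : (@RGenOInfty.G R).-sigma.-measurable `<=` D.
  by have [] : D B by apply: sD; rewrite -RGenOInfty.measurableE.
apply: smallest_sub; last first.
  move=> _ [a ->]; split; first exact: measurable_itv.
  split; last by rewrite setCitvr; apply: compact_regular_closed; exact: interval_closed.
  rewrite itvoyEbigcup; apply: compact_regular_bigcup => n; first exact: measurable_itv.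
  by apply: compact_regular_closed; exact: interval_closed.
split.
- split => //; rewrite setC0; split; apply: compact_regular_closed.
    exact: closed0.
  exact: closedT.
- by move=> A [mA [rA rCA]]; rewrite setTD; split; [exact: measurableC|rewrite setCK].
- move=> A DA; split.
    by apply: bigcupT_measurable => n; have [] := DA n.
  split; first by apply: compact_regular_bigcup => n; have [mA []] := DA n.
  rewrite setC_bigcup; apply: compact_regular_bigcap => n.
    by apply: measurableC; have [] := DA n.
  by have [mA []] := DA n.
Qed.
End inner_regularity.

Section coordinates.
Set Implicit Arguments.
Unset Strict Implicit.
Context {R : realType} {d : measure_display} {X : measurableType d}.
Context (mu : probability X R).

(* Standardness enters only through the last clause, which may fail for a
   measurable injection of a nonstandard space. *)
Definition coordinate (g : X -> R) (X1 : set X) : Prop :=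
  [/\ measurable X1, mu X1 = 1%E, measurable_fun setT g,
      (forall x, `|g x| <= 2) /\ {in X1 &, injective g} &
      forall (A : set X) (e : R), measurable A -> 0 < e ->
        exists K, [/\ measurable K, K `<=` A `&` X1, compact (g @` K) &
                      (mu (A `\` K) < e%:E)%E]].

Lemma measurable_preimage_fun (g : X -> R) (B : set R) :
  measurable_fun setT g -> measurable B -> measurable (g @^-1` B).
Proof. by move=> mg mB; rewrite -[X in measurable X]setTI; exact: mg. Qed.

(** Composing with the arctangent bounds the coordinate by pi / 2 < 2 and keeps injectivity and
    compactness of images. The compact sets come from inner regularity of a Borel set squeezed
    inside the image of [A] and [X1]. *)
Lemma standard_coordinate : standard_probability mu ->
  exists g X1, coordinate g X1.
Proof.
move=> [X1 [f [mX1 muX1 mf injf imf]]].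
have matan : measurable_fun setT (@atan R).
  by apply: continuous_measurable_fun => x; exact: continuous_atan.
exists (@atan R \o f), X1; split=> //.
- exact: measurableT_comp.
- split.
    move=> x /=; rewrite ler_norml.
    have := atan_gtNpi2 (f x); have := atan_ltpi2 (f x); have := @pihalf_lt2 R.
    by move=> ? ? ?; apply/andP; split; lra.
  move=> x y xX yX /= /(congr1 tan); rewrite !atanK => ?; exact: injf.
- move=> A e mA e0.
  have mA1 : measurable (A `&` X1) by exact: measurableI.
  have [||B [C [mB mC BA AC CB0]]] := imf (A `&` X1) => //.
  have [K0 [cK0 K0B K0e]] := measurable_compact_regular mu mf mB e0.
  have mK0 : measurable K0.
    by apply: closed_measurable; apply: compact_closed cK0; exact: order_hausdorff.
  exists (f @^-1` K0 `&` X1); split.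
  + by apply: measurableI => //; exact: measurable_preimage_fun.
  + move=> x [Kx X1x]; split => //.
    (* Some point [a] of [A] and [X1] has the same value as [x], and injectivity identifies the
       two. *)
    have [a [Aa X1a] fa] := BA _ (K0B _ Kx).
    by rewrite -(injf a x _ _ fa) ?inE.
  + rewrite (_ : _ @` _ = @atan R @` K0).
      apply: continuous_compact => //; apply: continuous_subspaceT => x.
      exact: continuous_atan.
    apply/seteqP; split => y [x].
      by move=> [Kx _] <-; exists (f x).
    move=> K0x <-; have [a [Aa X1a] fa] := BA _ (K0B _ K0x).
    by exists a; rewrite /= fa.
  + have mCB : measurable (f @^-1` (C `\` B)).
      by apply: measurable_preimage_fun => //; exact: measurableD.
    have mBK : measurable (f @^-1` (B `\` K0)).
      by apply: measurable_preimage_fun => //; exact: measurableD.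
    (* What is lost from [A] lies in the complement of [X1] and the preimage of [C] minus [B], both
       null, and in a set of measure below [e]. *)
    apply: (@le_lt_trans _ _ (mu (~` X1 `|` f @^-1` (C `\` B) `|` f @^-1` (B `\` K0)))).
      apply: le_measure; rewrite ?inE.
      * apply: measurableD => //; apply: measurableI => //.
        exact: measurable_preimage_fun.
      * apply: measurableU => //; apply: measurableU => //; exact: measurableC.
      * move=> x [Ax nK]; have [X1x|] := pselect (X1 x); last by left; left.
        have Cx : C (f x) by apply: AC; exists x.
        have [Bx|nBx] := pselect (B (f x)); last by left; right.
        by right; split => // Kx; apply: nK.
    apply: le_lt_trans K0e; apply: le_trans (measureU2 _ _ _) _ => //.
      by apply: measurableU => //; exact: measurableC.
    rewrite -[leRHS]add0e; apply: leeD => //.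
    apply: le_trans (measureU2 _ _ _) _ => //; first exact: measurableC.
    rewrite -[leRHS]adde0; apply: leeD; last by move/eqP: CB0; rewrite eq_le => /andP[].
    have : mu (~` X1) = 0%E by rewrite probability_setC// muX1 subee.
    by move/eqP; rewrite eq_le => /andP[].
Qed.

Context (g : X -> R) (X1 : set X) (cg : coordinate g X1).

Lemma diam_lt (rho : X -> X -> R) (A : set X) (e : R) x y :
  (diam rho A < e%:E)%E -> A x -> A y -> rho x y < e.
Proof.
move=> De Ax Ay; rewrite -lte_fin; apply: le_lt_trans De.
by apply: ereal_sup_ubound; exists x, y.
Qed.

Lemma lt_diam (rho : X -> X -> R) (A : set X) (r e : R) :
  (forall x y, A x -> A y -> rho x y <= r) -> r < e -> (diam rho A < e%:E)%E.
Proof.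
move=> Ar re; apply: (@le_lt_trans _ _ r%:E); last by rewrite lte_fin.
apply: ge_ereal_sup => _ [x [y [Ax Ay ->]]]; rewrite lee_fin; exact: Ar.
Qed.

(** [A] and its complement have inner approximations with compact images under [g]. These images are
    disjoint by injectivity, hence at a positive distance; [E] is what the approximations miss. *)
Lemma measurable_near_clopen (A : set X) (e : R) : measurable A -> 0 < e ->
  exists E, [/\ measurable E, (mu E < e%:E)%E & exists2 k : R, 0 < k &
    forall a b, ~ E a -> ~ E b -> `|g a - g b| < k -> A a -> A b].
Proof.
have [mX1 _ _ [_ injg] ir] := cg => mA e0.
have e2 : 0 < e / 2 by lra.
have [K [mK KA cK Ke]] := ir _ _ mA e2.
have [L [mL LA cL Le]] := ir _ _ (measurableC mA) e2.
exists (~` (K `|` L)); split.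
- by apply: measurableC; exact: measurableU.
  have -> : ~` (K `|` L) = (A `\` K) `|` (~` A `\` L).
    apply/seteqP; split => x; rewrite setCU.
      by move=> [nK nL]; have [?|?] := pselect (A x); [left|right].
    move=> [[Ax nK]|[Ax nL]]; split => //.
      by move=> /LA [].
    by move=> /KA [].
  have -> : e = e / 2 + e / 2 by lra.
  by apply: measure_setU_lt => //; apply: measurableD => //; exact: measurableC.
(* The set of differences is compact and avoids 0; the radius of a ball around 0 missing it serves
   as [k]. *)
- pose S := (fun z : R * R => z.1 - z.2) @` ((g @` K) `*` (g @` L)).
  have cS : closed S.
    apply: compact_closed; first exact: order_hausdorff.
    apply: continuous_compact; last exact: compact_setX.
    apply: continuous_subspaceT => z.
    by apply: continuousB; [exact: cvg_fst|exact: cvg_snd].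
  have S0 : nbhs (0 : R) (~` S).
    apply: open_nbhs_nbhs; split; first exact: closed_openC.
    move=> [[s t] /= [[x Kx <-] [y Ly <-]]] /eqP; rewrite subr_eq0 => /eqP xy.
    have [Ax X1x] := KA _ Kx; have [Ay X1y] := LA _ Ly; apply: Ay.
    by rewrite -(injg x y) ?inE.
  have /nbhs_ballP[k /= k0 kS] := S0.
  exists k => // a b /contrapT[Ka|La] /contrapT[Kb|Lb] ab Aa.
  + by have [] := KA _ Kb.
  + exfalso; apply: (kS (g a - g b)); first by rewrite /ball/= sub0r normrN.
    by exists (g a, g b) => //; split; [exists a|exists b].
  + by have [] := KA _ Kb.
  + by have [] := LA _ La.
Qed.

End coordinates.

(** * Bounding a semimetric by the coordinate *)

Section nonnegative_integrals.
Set Implicit Arguments.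
Unset Strict Implicit.
Context {R : realType} {d : measure_display} {X : measurableType d}.
Context (mu : probability X R).

Definition int_le (f : X -> R) (a : R) : Prop :=
  [/\ measurable_fun setT f, forall x, 0 <= f x &
      (\int[mu]_x (f x)%:E <= a%:E)%E].

Lemma int_leW (f : X -> R) (a b : R) : a <= b -> int_le f a -> int_le f b.
Proof. by move=> ab [mf f0 fa]; split => //; apply: le_trans fa _; rewrite lee_fin. Qed.

Lemma int_le_fun (f h : X -> R) (a : R) : measurable_fun setT f ->
  (forall x, 0 <= f x) -> (forall x, f x <= h x) -> int_le h a -> int_le f a.
Proof.
move=> mf f0 fh [mh h0 ha]; split => //; apply: le_trans ha.
apply: ge0_le_integral => //.
- by move=> x _; rewrite lee_fin.
- exact/measurable_EFinP.
- exact/measurable_EFinP.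
- by move=> x _; rewrite lee_fin.
Qed.

Lemma int_leD (f h : X -> R) (a b : R) : int_le f a -> int_le h b ->
  int_le (fun x => f x + h x) (a + b).
Proof.
move=> [mf f0 fa] [mh h0 hb]; split.
- exact: measurable_funD.
- by move=> x; rewrite addr_ge0.
under eq_integral do rewrite EFinD.
rewrite ge0_integralD//; first by rewrite EFinD leeD.
- by move=> x _; rewrite lee_fin.
- exact/measurable_EFinP.
- by move=> x _; rewrite lee_fin.
- exact/measurable_EFinP.
Qed.

Lemma int_leZ (f : X -> R) (c a : R) : 0 <= c -> int_le f a ->
  int_le (fun x => c * f x) (c * a).
Proof.
move=> c0 [mf f0 fa]; split.
- exact: measurable_funM.
- by move=> x; rewrite mulr_ge0.
under eq_integral do rewrite EFinM.
rewrite ge0_integralZl_EFin//; first by rewrite EFinM lee_wpmul2l ?lee_fin.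
- by move=> x _; rewrite lee_fin.
- exact/measurable_EFinP.
Qed.

Lemma int_le_cst (c : R) : 0 <= c -> int_le (fun=> c) c.
Proof.
move=> c0; split => //.
have := integral_cst mu (@measurableT _ X) c%:E.
by rewrite /cst => ->; rewrite [X in (_ * X)%E](@probability_setT _ _ _ mu) mule1.
Qed.

Lemma int_le_sum (f : nat -> X -> R) (a : R) n :
  (forall j, (j < n)%N -> int_le (f j) a) ->
  int_le (fun x => \sum_(j < n) f j x) (n%:R * a).
Proof.
elim: n => [|n IH] fa.
  rewrite mul0r; under eq_fun do rewrite big_ord0.
  exact: int_le_cst.
under eq_fun do rewrite big_ord_recr/=.
rewrite -natr1 mulrDl mul1r; apply: int_leD; last exact: fa.
by apply: IH => j jn; apply: fa; exact: ltnW.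
Qed.

Lemma int_le_indic (E : set X) (a : R) : measurable E -> (mu E <= a%:E)%E ->
  int_le (\1_E) a.
Proof.
move=> mE Ea; split; [exact: measurable_indic|by move=> x; rewrite indicE ler0n|].
by rewrite integral_indic// setIT.
Qed.

Lemma int_le_markov (f : X -> R) (a b : R) : 0 < a -> int_le f (a * b) ->
  measurable [set x | (a <= f x)%R] /\ (mu [set x | (a <= f x)%R] <= b%:E)%E.
Proof.
move=> a0 [mf f0 H]; split; first exact: measurable_ge.
have /= := le_integral_abse mu measurableT (g := EFin \o f) _ a0.
rewrite setTI => h0; have h := h0 (iffRL (measurable_EFinP _ _) mf).
rewrite -(@lee_pmul2l _ a%:E) ?lte_fin// -EFinM; apply: le_trans H.
rewrite [X in mu X](_ : _ = [set x | (a%:E <= `|(f x)%:E|)%E]); last first.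
  by apply/seteqP; split=> x /=; rewrite lee_fin ger0_norm.
apply: le_trans h _.
by under eq_integral do rewrite /= ger0_norm//.
Qed.

Definition preserving (T : X -> X) : Prop := measurable_fun setT T /\
  forall A : set X, measurable A -> mu (T @^-1` A) = mu A.

Lemma preserving_iter (T : X -> X) n : preserving T -> preserving (iter n T).
Proof.
move=> [mT pT]; elim: n => [|n [mI pI]]; first by split => //; exact: measurable_id.
split; first exact: (measurableT_comp mT mI).
move=> A mA; rewrite -(pI A mA) -[RHS]pT; last first.
  by rewrite -[X in measurable X]setTI; exact: mI.
by congr (mu _); apply/seteqP; split => x /=; rewrite -iterSr.
Qed.

Lemma integral_preserving (T : X -> X) (f : X -> R) : preserving T ->
  measurable_fun setT f -> (forall x, 0 <= f x) ->
  (\int[mu]_x (f (T x))%:E = \int[mu]_x (f x)%:E)%E.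
Proof.
move=> [mT pT] mf f0.
have <- : (\int[pushforward mu T]_y (f y)%:E = \int[mu]_x (f (T x))%:E)%E.
  rewrite (ge0_integral_pushforward mT) ?preimage_setT//.
    exact/measurable_EFinP.
  by move=> y _; rewrite lee_fin.
pose mT_mixin := isMeasurableFun.Build _ _ _ _ _ mT.
pose Tm : {mfun X >-> X} := HB.pack T mT_mixin.
apply: (@eq_measure_integral _ _ _ setT mu (pushforward mu Tm)) => A mA _.
exact: pT.
Qed.

Lemma int_le_preserving (T : X -> X) (f : X -> R) (a : R) : preserving T ->
  int_le f a -> int_le (fun x => f (T x)) a.
Proof.
move=> pT [mf f0 fa]; split => //.
  by apply: measurableT_comp => //; case: pT.
by rewrite integral_preserving.
Qed.

(** The excess of [h] over n tends to 0 pointwise and is dominated by [h]. *)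
Lemma int_le_tail (h : X -> R) (eta : R) : measurable_fun setT h ->
  (forall x, 0 <= h x) -> (\int[mu]_x (h x)%:E < +oo)%E -> 0 < eta ->
  exists2 M : R, 0 <= M & int_le (fun x => Order.max 0 (h x - M)) eta.
Proof.
move=> mh h0 hoo eta0.
pose f_ (n : nat) x := (Order.max 0 (h x - n%:R))%:E.
have mf n : measurable_fun setT (fun x => Order.max 0 (h x - n%:R)).
  by apply: measurable_maxr => //; exact: measurable_funB.
have [|||||_ _ +] := @dominated_convergence _ _ _ mu setT measurableT f_
    (cst 0%E) (EFin \o h).
- by move=> n; exact/measurable_EFinP.
- exact: measurable_cst.
- apply: aeW => x _; apply: cvg_near_cst.
  exists (Num.truncn (h x)).+1 => // n /= xn; rewrite /f_ max_l//.
  by rewrite subr_le0; apply/ltW/(lt_le_trans (truncnS_gt _)); rewrite ler_nat.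
- apply/integrableP; split; first exact/measurable_EFinP.
  by under eq_integral do rewrite /= ger0_norm//.
- apply: aeW => x n _ /=; rewrite /f_ lee_fin ger0_norm ?le_max ?lexx//.
  by rewrite ge_max h0/= lerBlDr lerDl.
rewrite integral0 => /(_ _ (open_ereal_lt' _)) /=.
have e0 : (0 < eta%:E)%E by rewrite lte_fin.
move=> /(_ _ e0)[N _ HN]; exists N%:R => //; split => //.
  by move=> x; rewrite le_max lexx.
by apply/ltW; exact: (HN N (leqnn N)).
Qed.

End nonnegative_integrals.

(** * Lusin-type uniformity of a semimetric in the coordinate *)

Section near_uniformity.
Set Implicit Arguments.
Unset Strict Implicit.
Context {R : realType} {d : measure_display} {X : measurableType d}.
Context (mu : probability X R).
Context (g : X -> R) (X1 : set X) (cg : coordinate mu g X1).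

(** Each of the finitely many pieces is nearly clopen for the coordinate: off a small set, a point
    close to [a] falls into the piece of [a], whose diameter is small. *)
Lemma decomposable_near_uniform (sigma : X -> X -> R) :
  (forall e : R, 0 < e -> exists k, decomposable mu sigma e k) ->
  forall e eta : R, 0 < e -> 0 < eta ->
  exists E, [/\ measurable E, (mu E < eta%:E)%E & exists2 kappa : R, 0 < kappa &
    forall a b, ~ E a -> ~ E b -> `|g a - g b| < kappa -> sigma a b < e].
Proof.
move=> dec e eta e0 eta0.
(* One threshold serves two purposes: diameters below [e], and a discarded piece [A 0] of measure
   below [eta / 2]. *)
have m0 : 0 < Order.min e (eta / 2) by rewrite lt_min e0/=; lra.
have [k [k0 [A [mA cA A0 Ai]]]] := dec _ m0.
(* The guard [n <= k] makes the property vacuous beyond the last piece, where the empty exceptional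
   set is enough. *)
pose P n (E : set X) := (n <= k)%N -> exists2 kappa : R, 0 < kappa &
  forall a b, ~ E a -> ~ E b -> `|g a - g b| < kappa -> A n a -> A n b.
have [|||E [mE muE PE]] := @eventually_small _ _ _ mu P _ _ (eta / 2).
- move=> n E F EF PnE nk; have [kappa kappa0 H] := PnE nk.
  by exists kappa => // a b Fa Fb; apply: H => ?; [apply: Fa|apply: Fb]; exact: EF.
- move=> n c c0; have [nk|nk] := leqP n k.
    have [E [mE Ec H]] := measurable_near_clopen cg (mA n nk) c0.
    by exists E; split.
  exists set0; split => //; first by rewrite measure0.
  by move=> nk'; move: nk; rewrite ltnNge nk'.
- lra.
have [kappa kappa0 H] : exists2 kappa : R, 0 < kappa & forall n, (n <= k)%N ->
    forall a b, ~ E a -> ~ E b -> `|g a - g b| < kappa -> A n a -> A n b.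
  have : forall m, exists2 kappa : R, 0 < kappa & forall n, (n < m)%N -> (n <= k)%N ->
      forall a b, ~ E a -> ~ E b -> `|g a - g b| < kappa -> A n a -> A n b.
    elim=> [|m [c c0 IH]]; first by exists 1.
    have [mk|km] := leqP m k; last first.
      exists c => // n; rewrite ltnS leq_eqVlt => /orP[/eqP->|]; last exact: IH.
      by rewrite leqNgt km.
    have [c' c'0 IH'] := PE m mk.
    exists (Order.min c c'); first by rewrite lt_min c0.
    move=> n; rewrite ltnS leq_eqVlt => /orP[/eqP->|nm] nk a b Ea Eb;
      rewrite lt_min => /andP[h h'].
      exact: IH'.
    exact: IH.
  move=> /(_ k.+1)[kappa kappa0 H]; exists kappa => // n nk.
  exact: (H n _ nk).
exists (A 0%N `|` E); split.
- by apply: measurableU => //; exact: mA.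
- have -> : eta = eta / 2 + eta / 2 by lra.
  apply: measure_setU_lt => //; first exact: mA.
  by apply: (lt_le_trans A0); rewrite lee_fin ge_min lexx orbT.
- exists kappa => // a b /not_orP[A0a Ea] /not_orP[A0b Eb] ab.
  have : [set: X] a by [].
  rewrite -cA => -[i /= ik Aia].
  have i0 : (0 < i)%N by case: i {ik} Aia => // /A0a.
  have Dlt : (diam sigma (A i) < (Order.min e (eta / 2))%:E)%E.
    by apply: Ai; rewrite i0.
  apply: lt_le_trans (diam_lt Dlt Aia _) _; last by rewrite ge_min lexx.
  exact: (H i ik a b).
Qed.

End near_uniformity.

(** * Decompositions, entropy and integrable sections *)

Section entropy.
Set Implicit Arguments.
Unset Strict Implicit.
Context {R : realType} {d : measure_display} {X : measurableType d}.
Context (mu : probability X R).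

Lemma log2_nat_le (k m : nat) : (0 < k)%N -> (k <= m)%N ->
  ln (k%:R : R) / ln 2 <= ln m%:R / ln 2.
Proof.
move=> k0 km; rewrite ler_pM2r; last by rewrite invr_gt0 ln_gt0// ltr1n.
by rewrite ler_ln ?ler_nat// posrE ltr0n// (leq_trans k0).
Qed.

Lemma eps_entropy_le (rho : X -> X -> R) (e : R) k : decomposable mu rho e k ->
  (eps_entropy mu rho e <= (ln k%:R / ln 2)%:E)%E.
Proof.
move=> dk; rewrite /eps_entropy; case: pselect => [ex|/(_ _)[]]; last first.
  by exists k; apply/asboolP.
case: ex_minnP => m /asboolP[m0 _] mk; rewrite lee_fin; apply: log2_nat_le => //.
by apply: mk; apply/asboolP.
Qed.

Lemma eps_entropy_fin (rho : X -> X -> R) (e : R) :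
  (eps_entropy mu rho e < +oo)%E ->
  exists2 k, decomposable mu rho e k & eps_entropy mu rho e = (ln k%:R / ln 2)%:E.
Proof.
rewrite /eps_entropy; case: pselect => [ex _|]; last by rewrite ltxx.
by case: ex_minnP => m /asboolP dm _; exists m.
Qed.

Lemma admissible_decomposable (rho : X -> X -> R) : admissible mu rho ->
  forall e : R, 0 < e -> exists k, decomposable mu rho e k.
Proof. by move=> a e e0; have [k dk _] := eps_entropy_fin (a e e0); exists k. Qed.

Lemma decomposable_preserving (T : X -> X) (rho : X -> X -> R) (e : R) k :
  preserving mu T -> decomposable mu rho e k ->
  decomposable mu (fun x y => rho (T x) (T y)) e k.
Proof.
move=> [mT pT] [k0 [A [mA cA A0 Ai]]]; split => //.
exists (fun i => T @^-1` A i); split.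
- by move=> i ik; rewrite -[X in measurable X]setTI; apply: mT => //; exact: mA.
- apply/seteqP; split => // x _; have : [set: X] (T x) by [].
  by rewrite -cA => -[i ik ATx]; exists i.
- by rewrite pT//; exact: mA.
- move=> i ik; apply: le_lt_trans (Ai i ik).
  apply: ereal_sup_le => _ [x [y [Ax Ay ->]]].
  by exists (T x), (T y).
Qed.

Lemma measurable_section (rho : X -> X -> R) (x0 : X) :
  measurable_fun setT (fun z : X * X => rho z.1 z.2) ->
  measurable_fun setT (fun x => rho x x0).
Proof.
by move=> mr; exact: (measurable_fun_pair1 (f := fun z : X * X => rho z.1 z.2)).
Qed.

(** By Tonelli, infinite integrals of all sections would make the double integral infinite. The base
    point gives the majorant [rho a x0 + rho b x0] of [rho a b], with both terms integrable. *)
Lemma integrable_section (rho : X -> X -> R) : measurable_semimetric rho ->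
  (\int[(mu \x mu)%E]_z (rho z.1 z.2)%:E < +oo)%E ->
  exists x0, (\int[mu]_x (rho x x0)%:E < +oo)%E.
Proof.
move=> [r0 rs _ mr] ioo; apply/not_existsP => H.
move: ioo; rewrite fubini_tonelli1/=; last 2 first.
- exact/measurable_EFinP.
- by move=> z; rewrite lee_fin.
have -> : (fun x => fubini_F mu (fun z : X * X => (rho z.1 z.2)%:E) x) = cst +oo%E.
  apply/funext => x; rewrite /fubini_F /=.
  have := H x; under eq_integral do rewrite rs.
  by move/negP; rewrite ltey negbK => /eqP.
rewrite integral_cst// [X in (_ * X)%E](@probability_setT _ _ _ mu).
by rewrite mule1 ltxx.
Qed.

End entropy.

Section coordinate_bound.
Set Implicit Arguments.
Unset Strict Implicit.
Context {R : realType} {d : measure_display} {X : measurableType d}.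
Context (mu : probability X R).
Context (g : X -> R) (X1 : set X) (cg : coordinate mu g X1).

(** Off a small set [E], close coordinates force a distance below [e]. Otherwise [rho a b] is at
    most 2 M plus the tails of [h] above [M]; the amount 2 M is paid by [u] on [E], and by the term
    in [L] when the coordinates are at least [kappa] apart. *)
Lemma semimetric_le_coordinate (rho : X -> X -> R) (x0 : X) :
  measurable_semimetric rho ->
  (forall e : R, 0 < e -> exists k, decomposable mu rho e k) ->
  (\int[mu]_x (rho x x0)%:E < +oo)%E ->
  forall e : R, 0 < e -> exists L u, [/\ 0 <= L, int_le mu u e &
    forall a b, rho a b <= e + L * `|g a - g b| + u a + u b].
Proof.
move=> [r0 rs rt mr] dec ioo e e0.
pose h x := rho x x0.
have mh : measurable_fun setT h by exact: measurable_section.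
have e2 : 0 < e / 2 by lra.
have [M M0 tailM] := int_le_tail mh (fun x => r0 x x0) ioo e2.
(* This measure for [E] makes its cost 2 M mu(E) at most e / 2, the other half going to the tail;
   the added 1 covers M = 0. *)
have eta0 : 0 < e / 2 / (2 * M + 1) by rewrite !divr_gt0//; lra.
have [E [mE Eeta [kappa kappa0 HE]]] := decomposable_near_uniform cg dec e0 eta0.
exists (2 * M / kappa), (fun x => 2 * M * \1_E x + Order.max 0 (h x - M)); split.
- by rewrite divr_ge0//; lra.
- apply: (@int_leW _ _ _ _ _ (2 * M * (e / 2 / (2 * M + 1)) + e / 2)).
    have : 2 * M * (e / 2 / (2 * M + 1)) <= e / 2.
      by rewrite mulrA ler_pdivrMr; nra.
    lra.
  apply: int_leD => //; apply: int_leZ; first lra.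
  by apply: int_le_indic => //; exact: ltW.
move=> a b.
have t c : h c <= M + Order.max 0 (h c - M).
  by rewrite -lerBlDl le_max lexx orbT.
have m0 c : 0 <= Order.max 0 (h c - M) by rewrite le_max lexx.
have i0 c : 0 <= 2 * M * \1_E c.
  by rewrite mulr_ge0 ?mulr_ge0// indicE ler0n.
have d0 : 0 <= 2 * M / kappa * `|g a - g b|.
  by rewrite mulr_ge0// divr_ge0 ?mulr_ge0// ltW.
have tri : rho a b <= h a + h b by apply: le_trans (rt a x0 b) _; rewrite (rs x0).
have ta := t a; have tb := t b; have ma := m0 a; have mb := m0 b.
have ia := i0 a; have ib := i0 b.
have [Ea|nEa] := pselect (E a).
  have : 2 * M * \1_E a = 2 * M by rewrite indicE mem_set// mulr1.
  lra.
have [Eb|nEb] := pselect (E b).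
  have : 2 * M * \1_E b = 2 * M by rewrite indicE mem_set// mulr1.
  lra.
have [ab|ab] := ltP `|g a - g b| kappa.
  have := HE a b nEa nEb ab; lra.
have : 2 * M <= 2 * M / kappa * `|g a - g b|.
  by rewrite -mulrA ler_peMr ?mulr_ge0// mulrC ler_pdivlMr// mul1r.
lra.
Qed.

End coordinate_bound.

(** * Coding of orbit segments *)

Section coding.
Set Implicit Arguments.
Unset Strict Implicit.
Context {R : realType} {d : measure_display} {X : measurableType d}.
Context (mu : probability X R) (T S : X -> X).
Context (TS : cancel T S).
Context (pT : preserving mu T) (mS : measurable_fun setT S).

Lemma iter_cancel n : cancel (iter n T) (iter n S).
Proof. by elim: n => // n IH x; rewrite iterSr iterS TS IH. Qed.

Lemma iter_measurable n : measurable_fun setT (iter n S).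
Proof.
by elim: n => [|n IH]; [exact: measurable_id|exact: (measurableT_comp mS IH)].
Qed.

Context (g : X -> R) (mg : measurable_fun setT g).

Definition measurable_code (I : finType) (c : X -> I) :=
  forall i, measurable (c @^-1` [set i]).

Lemma measurable_code_preimage (I : finType) (c : X -> I) (D : set I) :
  measurable_code c -> measurable (c @^-1` D).
Proof.
move=> mc; rewrite (_ : _ @^-1` _ = \bigcup_(i in D) (c @^-1` [set i])).
  by apply: fin_bigcup_measurable => [|i _]; [exact: finite_finset|exact: mc].
by apply/seteqP; split => [x Dx|x [i /= Di ci]]; [exists (c x)|rewrite /= ci].
Qed.

Lemma measurable_code_comp (I : finType) (c : X -> I) (f : I -> R) :
  measurable_code c -> measurable_fun setT (fun x => f (c x)).
Proof.
move=> mc _ Y mY; rewrite setTI.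
exact: (measurable_code_preimage (f @^-1` Y) mc).
Qed.

(** The words [q i] are arbitrary, not orbits of points. The error is summed rather than averaged,
    so that the budgets of consecutive blocks add up. *)
Definition coded (n : nat) (e : R) (k : nat) : Prop := (0 < k)%N /\
  exists (I : finType) (c : X -> I) (q : I -> nat -> R),
    [/\ #|I| = k, measurable_code c &
        int_le mu (fun x => \sum_(j < n) `|g (iter j T x) - q (c x) j|) (n%:R * e)].

Lemma coded_le (n : nat) (e e' : R) (k : nat) : e <= e' -> coded n e k -> coded n e' k.
Proof.
move=> ee' [k0 [I [c [q [cI mc H]]]]]; split => //; exists I, c, q; split => //.
by apply: int_leW H; rewrite ler_wpM2l.
Qed.

Lemma coded_measurable (I : finType) (c : X -> I) (q : I -> nat -> R) n :
  measurable_code c ->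
  measurable_fun setT (fun x => \sum_(j < n) `|g (iter j T x) - q (c x) j|).
Proof.
move=> mc; apply: (@measurable_sum _ _ _ _ 'I_n _
  (fun j x => `|g (iter j T x) - q (c x) j|)) => j.
apply: measurableT_comp => //; apply: measurable_funB.
  by apply: (measurableT_comp mg); have [] := preserving_iter j pT.
exact: (measurable_code_comp (fun i => q i j)).
Qed.

(* The code of the second block is read after shifting by T^-a: this is where
   invertibility of T is needed. *)
Lemma coded_split (a b : nat) (e : R) (k : nat) : coded (a + b) e k ->
  coded a e k \/ coded b e k.
Proof.
move=> [k0 [I [c [q [cI mc [mF F0 FI]]]]]].
pose F1 x := \sum_(j < a) `|g (iter j T x) - q (c x) j|.
pose c' x := c (iter a S x).
pose q' i j := q i (a + j)%N.
pose F2 x := \sum_(j < b) `|g (iter j T x) - q' (c' x) j|.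
have mc' : measurable_code c'.
  move=> i; rewrite -[X in measurable X]setTI.
  exact: (iter_measurable a measurableT (mc i)).
have mF1 : measurable_fun setT F1 by exact: coded_measurable.
have mF2 : measurable_fun setT F2 by exact: coded_measurable.
have F10 x : 0 <= F1 x by exact: sumr_ge0.
have F20 x : 0 <= F2 x by exact: sumr_ge0.
have mF2' : measurable_fun setT (fun x => F2 (iter a T x)).
  by apply: (measurableT_comp mF2); have [] := preserving_iter a pT.
have F12 : (\int[mu]_x (F1 x)%:E + \int[mu]_x (F2 x)%:E <= ((a + b)%:R * e)%:E)%E.
  rewrite -(integral_preserving (preserving_iter a pT) mF2 F20).
  rewrite -ge0_integralD//; first last.
  - exact/measurable_EFinP.
  - by move=> x _; rewrite lee_fin.
  - exact/measurable_EFinP.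
  - by move=> x _; rewrite lee_fin.
  apply: le_trans FI; rewrite le_eqVlt; apply/orP; left; apply/eqP.
  apply: eq_integral => x _; rewrite -EFinD; congr (_%:E).
  rewrite big_split_ord/=; congr (_ + _); apply: eq_bigr => j _.
  by rewrite /c' /q' iter_cancel -iterD addnC.
(* The two block errors add up to at most (a + b) e, so one of them is within its own share. *)
have [le1|lt1] := leP (\int[mu]_x (F1 x)%:E)%E (a%:R * e)%:E.
  by left; split => //; exists I, c, q; split.
right; split => //; exists I, c', q'; split => //; split => //.
rewrite leNgt; apply/negP => lt2; move: F12; apply/negP; rewrite -ltNge.
by rewrite natrD mulrDl EFinD lteD.
Qed.

Lemma coded_cat (a b : nat) (e : R) (k m : nat) : coded a e k -> coded b e m ->
  coded (a + b) e (k * m).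
Proof.
move=> [k0 [I [c [q [cI mc HI]]]]] [m0 [J [c' [q' [cJ mc' HJ]]]]].
split; first by rewrite muln_gt0 k0.
exists (I * J)%type, (fun x => (c x, c' (iter a T x))),
  (fun ij l => if (l < a)%N then q ij.1 l else q' ij.2 (l - a)%N); split.
- by rewrite card_prod cI cJ.
- move=> [i j].
  rewrite (_ : _ @^-1` _ = c @^-1` [set i] `&` (c' \o iter a T) @^-1` [set j]).
    apply: measurableI => //; rewrite -[X in measurable X]setTI comp_preimage.
    by have [mi _] := preserving_iter a pT; exact: (mi measurableT _ (mc' j)).
  by apply/seteqP; split => x /=; [move=> [<- <-]|move=> [<- <-]].
- have := int_leD HI (int_le_preserving (preserving_iter a pT) HJ).
  rewrite -mulrDl -natrD; congr (int_le _ _ _); apply/funext => x.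
  rewrite big_split_ord/=; congr (_ + _); apply: eq_bigr => j _.
    by rewrite ltn_ord.
  by rewrite ltnNge leq_addr/= addKn -iterD addnC.
Qed.

Lemma coded_power (n : nat) (e : R) (k m : nat) : coded n e k ->
  exists k', coded (m.+1 * n) e k'.
Proof.
move=> cn; elim: m => [|m [k' IH]]; first by exists k; rewrite mul1n.
by exists (k * k')%N; rewrite mulSn; exact: coded_cat.
Qed.

(** As long as m >= 2n, split off a block of length n: either it is coded well or the remaining m -
    n letters are, and induction applies. Once m < 2n, the first n letters inherit an error of at
    most m e <= 2 n e. *)
Lemma coded_restrict (n m : nat) (e : R) (k : nat) : (0 < n)%N -> (n <= m)%N ->
  0 <= e -> coded m e k -> coded n (2 * e) k.
Proof.
move=> n0 + e0; elim/ltn_ind: m => m IH nm.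
have [nm2 cm|m2n] := leqP (n + n)%N m.
  have : coded (n + (m - n)) e k by rewrite subnKC.
  move=> /coded_split[cn|]; first by apply: coded_le cn; lra.
  by apply: IH; [rewrite ltn_subrL n0 (leq_trans n0)|rewrite leq_subRL].
move=> [k0 [I [c [q [cI mc H]]]]]; split => //; exists I, c, q; split => //.
apply: (@int_leW _ _ _ _ _ (m%:R * e)).
  rewrite mulrA; apply: ler_wpM2r => //; rewrite -natrM ler_nat muln2 -addnn.
  exact: ltnW.
apply: int_le_fun H; first exact: coded_measurable.
  by move=> x; exact: sumr_ge0.
move=> x; rewrite -(subnKC nm) big_split_ord/= lerDl; exact: sumr_ge0.
Qed.

End coding.

Section codes.
Set Implicit Arguments.
Unset Strict Implicit.
Context {R : realType} {d : measure_display} {X : measurableType d}.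
Context (mu : probability X R).

Lemma measurable_code_ffun (J I : finType) (c : J -> X -> I) :
  (forall j, measurable_code (c j)) ->
  measurable_code (fun x => [ffun j => c j x]).
Proof.
move=> mc v.
rewrite (_ : _ @^-1` _ = \bigcap_(j in [set: J]) (c j @^-1` [set v j])).
  by apply: fin_bigcap_measurable => [|j _]; [exact: finite_finset|exact: mc].
apply/seteqP; split => [x /= <- j _|x H /=]; first by rewrite /= ffunE.
by apply/ffunP => j; rewrite ffunE; exact: H.
Qed.

Lemma measurable_code_asbool (A : set X) : measurable A ->
  measurable_code (fun x => `[< A x >]).
Proof.
move=> mA [].
  rewrite (_ : _ @^-1` _ = A)//; apply/seteqP; split=> x /=; first by move/asboolP.
  by move=> Ax; apply/asboolP.
rewrite (_ : _ @^-1` _ = ~` A); first exact: measurableC.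
by apply/seteqP; split=> x /=; [move/asboolPn|move=> ?; apply/asboolPn].
Qed.

(** A piece containing [x] is chosen as a function of the finite vector of memberships of [x], so
    the choice is measurable even when pieces overlap. *)
Lemma decomposable_code (sigma : X -> X -> R) (e : R) k :
  decomposable mu sigma e k -> exists (c : X -> 'I_k) (Z : set X),
    [/\ measurable_code c, measurable Z, (mu Z < e%:E)%E &
        forall x y, ~ Z x -> ~ Z y -> c x = c y -> sigma x y < e].
Proof.
move=> [k0 [A [mA cA A0 Ai]]].
pose b x := [ffun i : 'I_k => `[< A i.+1 x >]].
(* The default value is taken only at points of no piece of positive index, which lie in [A 0]. *)
pose phi (v : {ffun 'I_k -> bool}) : 'I_k := odflt (Ordinal k0) [pick i | v i].
have mb : measurable_code b.
  by apply: measurable_code_ffun => i; apply: measurable_code_asbool; exact: mA.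
exists (phi \o b), (A 0%N); split => //.
- by move=> i; rewrite comp_preimage; exact: measurable_code_preimage.
- exact: mA.
have AP x : ~ A 0%N x -> A (phi (b x)).+1 x.
  move=> A0x; rewrite /phi; case: pickP => [i|H] /=.
    by rewrite ffunE => /asboolP.
  have : [set: X] x by [].
  rewrite -cA => -[[|i] /= ik Aix]; first by [].
  have := H (Ordinal ik); rewrite ffunE/= => /asboolP; contradiction.
move=> x y Zx Zy xy; apply: (diam_lt (A := A (phi (b x)).+1)).
- by apply: Ai => //=.
- exact: AP.
- by rewrite -[phi _]/((phi \o b) x) xy; exact: AP.
Qed.

(** The pieces are the fibres of the code with [Z] removed. A diameter is a supremum, hence the gap
    between [r] and [e]. *)
Lemma code_decomposable (sigma : X -> X -> R) (e r : R) (I : finType) (c : X -> I)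
    (Z : set X) : (0 < #|I|)%N -> measurable_code c -> measurable Z ->
  (mu Z < e%:E)%E -> r < e ->
  (forall x y, ~ Z x -> ~ Z y -> c x = c y -> sigma x y <= r) ->
  decomposable mu sigma e #|I|.
Proof.
move=> I0 mc mZ Ze re H; split => //.
exists (fun i => if i is j.+1 then
    c @^-1` [set v | enum_rank v = j :> nat] `\` Z else Z); split => //.
- move=> [|j] _ //; apply: measurableD => //; exact: measurable_code_preimage.
- apply/seteqP; split => // x _; have [Zx|Zx] := pselect (Z x); first by exists 0%N.
  by exists (enum_rank (c x)).+1 => //=.
- move=> [|j] // _; apply: lt_diam re => x y [cx Zx] [cy Zy]; apply: H => //.
  by apply: enum_rank_inj; apply: val_inj; rewrite /= cx cy.
Qed.

End codes.

(** * Codes and decompositions *)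

Section entropy_comparison.
Set Implicit Arguments.
Unset Strict Implicit.
Context {R : realType} {d : measure_display} {X : measurableType d}.
Context (mu : probability X R) (T : X -> X) (pT : preserving mu T).
Context (g : X -> R) (X1 : set X) (cg : coordinate mu g X1).

(** Two points with the same code are compared through their common word. By Markov, the errors of
    both are small off a small set, so fibres of the code have small diameter for the average. *)
Lemma coded_decomposable (rho : X -> X -> R) :
  (forall e : R, 0 < e -> exists L u, [/\ 0 <= L, int_le mu u e &
    forall a b, rho a b <= e + L * `|g a - g b| + u a + u b]) ->
  forall e : R, 0 < e -> exists2 delta : R, 0 < delta &
    forall n k, (0 < n)%N -> coded mu T g n delta k ->
      decomposable mu (averaged T rho n) e k.
Proof.
move=> D e e0.
(* The first bound gives averages at most e1 + e/4 + e/4 <= 3e/4; the second, with the same bound on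
   L delta, keeps the integral of [w] below its Markov budget. *)
have e10 : 0 < Order.min (e / 4) (e * e / 32).
  by rewrite lt_min; apply/andP; split; rewrite divr_gt0// mulr_gt0.
set e1 := Order.min _ _ in e10; have [L [u [L0 uI H]]] := D _ e10.
have e1a : e1 <= e / 4 by rewrite ge_min lexx.
have e1b : e1 <= e * e / 32 by rewrite ge_min lexx orbT.
pose delta := e * e / 32 / (L + 1).
have delta0 : 0 < delta by rewrite !divr_gt0 ?mulr_gt0//; lra.
have Ldelta : L * delta <= e * e / 32.
  by rewrite /delta mulrA ler_pdivrMr; nra.
exists delta => // n k n0 [k0 [I [c [q [cI mc qI]]]]]; rewrite -cI.
have nR : 0 < n%:R :> R by rewrite ltr0n.
pose dev x := \sum_(j < n) `|g (iter j T x) - q (c x) j|.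
pose w x := L * dev x + \sum_(j < n) u (iter j T x).
have wI : int_le mu w ((n%:R * (e / 4)) * (e / 2)).
  apply: (@int_leW _ _ _ _ _ (L * (n%:R * delta) + n%:R * e1)).
    rewrite mulrCA -mulrDr -mulrA ler_pM2l//; nra.
  apply: int_leD; first exact: int_leZ.
  apply: (@int_le_sum _ _ _ _ (fun j x => u (iter j T x))) => j _.
  exact: (int_le_preserving (preserving_iter j pT)).
have ne0 : 0 < n%:R * (e / 4) by rewrite mulr_gt0// divr_gt0.
have [mZ Ze] := int_le_markov ne0 wI.
apply: (@code_decomposable _ _ _ _ _ e (3 / 4 * e) I c _ _ mc mZ).
- by rewrite cI.
- by apply: le_lt_trans Ze _; rewrite lte_fin; lra.
- lra.
move=> x y /negP; rewrite -ltNge => wx /negP; rewrite -ltNge => wy cxy.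
rewrite /averaged ler_pdivrMl//.
apply: (@le_trans _ _ (n%:R * e1 + w x + w y)); last by nra.
have -> : n%:R * e1 + w x + w y = \sum_(j < n) (e1 + L *
    (`|g (iter j T x) - q (c x) j| + `|g (iter j T y) - q (c y) j|) +
    u (iter j T x) + u (iter j T y)).
  rewrite !big_split/= sumr_const card_ord -[e1 *+ n]mulr_natl -mulr_sumr big_split/=.
  by rewrite /w /dev; ring.
apply: ler_sum => j _; apply: le_trans (H _ _) _; rewrite -cxy !lerD2r lerD2l.
apply: ler_wpM2l => //; rewrite [`|g (iter j T y) - _|]distrC.
exact: ler_distD.
Qed.

Lemma coordinate_le_semimetric (rho : X -> X -> R) :
  measurable_semimetric rho ->
  (forall e : R, 0 < e -> exists k, decomposable mu rho e k) ->
  generating mu T rho ->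
  forall e : R, 0 < e -> exists (N : nat) L u, [/\ 0 <= L, int_le mu u e &
    forall a b, `|g a - g b| <=
      e + L * (\sum_(i < N) rho (iter i T a) (iter i T b)) + u a + u b].
Proof.
move=> [r0 rs rt mr] dec [X' [mX' X'1 gen]] e e0.
have [mX1 X11 mg [gle injg] ir] := cg.
(* A single set [E] makes every shifted [rho] uniform in the coordinate at every precision 1 / (i +
   1). *)
have [|||E [mE Ee HE]] := @eventually_small _ _ _ mu (fun j E => forall i,
    exists2 kappa : R, 0 < kappa & forall a b, ~ E a -> ~ E b ->
      `|g a - g b| < kappa -> rho (iter j T a) (iter j T b) < i.+1%:R^-1) _ _ (e / 8).
- move=> j E F EF H i; have [kappa k0 Hk] := H i.
  by exists kappa => // a b Fa Fb; apply: Hk => ?; [apply: Fa|apply: Fb]; exact: EF.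
- move=> j eta eta0.
  apply: (@eventually_small _ _ _ mu (fun i E =>
    exists2 kappa : R, 0 < kappa & forall a b, ~ E a -> ~ E b ->
      `|g a - g b| < kappa -> rho (iter j T a) (iter j T b) < i.+1%:R^-1)) => //.
    move=> i E F EF [kappa k0 Hk].
    by exists kappa => // a b Fa Fb; apply: Hk => ?; [apply: Fa|apply: Fb]; exact: EF.
  move=> i c c0; apply: (decomposable_near_uniform cg) => //.
  move=> r r00; have [k dk] := dec r r00; exists k.
  exact: (decomposable_preserving (preserving_iter j pT)).
- lra.
have e8 : 0 < e / 8 by lra.
have mXE : measurable (X' `&` ~` E) by apply: measurableI => //; exact: measurableC.
(* The counterexamples will live in [K]: its image is compact, [rho] separates its points along
   orbits, and the uniformity off [E] holds on it. *)
have [K [mK KE cK Ke]] := ir _ _ mXE e8.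
have KcI : (mu (~` K) <= (e / 4)%:E)%E.
  apply: (@le_trans _ _ (mu (~` X' `|` (E `|` ((X' `&` ~` E) `\` K))))).
    apply: le_measure; rewrite ?inE; [exact: measurableC| |].
      by repeat (apply: measurableU => //); [exact: measurableC|exact: measurableD].
    move=> x Kx; have [X'x|] := pselect (X' x); last by left.
    by have [Ex|Ex] := pselect (E x); right; [left|right].
  apply: le_trans (measureU2 _ _ _) _; [exact: measurableC| |].
    by apply: measurableU => //; exact: measurableD.
  rewrite -[leRHS]add0e; apply: leeD.
    have : mu (~` X') = 0%E by rewrite probability_setC// X'1 subee.
    by move/eqP; rewrite eq_le => /andP[].
  have -> : e / 4 = e / 8 + e / 8 by lra.
  by apply/ltW/measure_setU_lt => //; exact: measurableD.
(* The same [m] serves as [N] and as [L]. Off [K] the bound |g| <= 2 costs at most 4, on a set of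
   measure at most e / 4. *)
suff [m Hm] : exists m : nat, forall a b, K a -> K b -> `|g a - g b| <=
    e + m%:R * (\sum_(i < m) rho (iter i T a) (iter i T b)).
  exists m, m%:R, (fun x => 4 * \1_(~` K) x); split => //.
    have -> : e = 4 * (e / 4) by lra.
    by apply: int_leZ => //; apply: int_le_indic => //; exact: measurableC.
  move=> a b.
  have i0 c : 0 <= 4 * \1_(~` K) c :> R by rewrite mulr_ge0// indicE ler0n.
  have s0 : 0 <= m%:R * (\sum_(i < m) rho (iter i T a) (iter i T b)).
    by rewrite mulr_ge0// sumr_ge0.
  have ia := i0 a; have ib := i0 b.
  have [Ka|Ka] := pselect (K a); first have [Kb|Kb] := pselect (K b).
  - have := Hm a b Ka Kb; lra.
  - have : 4 * \1_(~` K) b = 4 :> R by rewrite indicE mem_set// mulr1.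
    have := ler_normB (g a) (g b); have := gle a; have := gle b; lra.
  - have : 4 * \1_(~` K) a = 4 :> R by rewrite indicE mem_set// mulr1.
    have := ler_normB (g a) (g b); have := gle a; have := gle b; lra.
apply/not_existsP => Hno.
(* If no m works, a cluster point of the counterexamples is a pair of distinct
   points of K at zero distance for every average of rho. *)
have /choice[xy Hxy] : forall m, exists p : X * X, [/\ K p.1, K p.2 &
    e + m%:R * (\sum_(i < m) rho (iter i T p.1) (iter i T p.2)) < `|g p.1 - g p.2|].
  move=> m; have /existsNP[a /existsNP[b /not_implyP[Ka /not_implyP[Kb]]]] := Hno m.
  by move/negP; rewrite -ltNge => H; exists (a, b).
have := compact_setX cK cK.
move=> /(_ ((fun m => (g (xy m).1, g (xy m).2)) @ \oo) _)[].
  exists 0%N => // m _ /=; have [K1 K2 _] := Hxy m.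
  by split; [exists (xy m).1|exists (xy m).2].
move=> [s t] [[[x Kx /= <-] [y Ky /= <-]] cl].
have near_xy (M : nat) (kappa : R) : 0 < kappa -> exists m, [/\ (M <= m)%N,
    `|g x - g (xy m).1| < kappa & `|g y - g (xy m).2| < kappa].
  move=> kappa0.
  have [||[_ _] [[m /= Mm [<- <-]] [/= b1 b2]]] := cl
    [set (g (xy m).1, g (xy m).2) | m in [set m | (M <= m)%N]]
    (ball (g x) kappa `*` ball (g y) kappa).
  - by exists M => // m Mm; exists m.
  - by exists (ball (g x) kappa, ball (g y) kappa) => //; split; exact: nbhsx_ballx.
  by exists m; split.
(* The coordinates of each counterexample differ by more than [e], which a common limit would
   contradict. *)
have xNy : x <> y.
  move=> xy'; have e2 : 0 < e / 2 by lra.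
  have [m [_ h1 h2]] := near_xy 0%N _ e2.
  have [_ _] := Hxy m; apply/negP; rewrite -leNgt.
  have : 0 <= m%:R * (\sum_(i < m) rho (iter i T (xy m).1) (iter i T (xy m).2)).
    by rewrite mulr_ge0// sumr_ge0.
  have := ler_distD (g x) (g (xy m).1) (g (xy m).2).
  rewrite (distrC (g (xy m).1) (g x)); move: h2; rewrite -xy'; lra.
have [X'x Ex] : X' x /\ ~ E x by have [[]] := KE _ Kx.
have [X'y Ey] : X' y /\ ~ E y by have [[]] := KE _ Ky.
have [n [n0 avn]] := gen x y X'x X'y xNy.
(* The positive distance [r] at time [j] will be contradicted by three legs below r / 3: from [x] to
   the first point of a counterexample, between its two points, and on to [y]. *)
have [j rj] : exists j, 0 < rho (iter j T x) (iter j T y).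
  apply/not_existsP => H; move: avn; rewrite /averaged big1 ?mulr0 ?ltxx// => i _.
  by apply/eqP; rewrite eq_le r0 andbT leNgt; apply/negP; exact: H.
set r := rho _ _ in rj.
have r3 : 0 < r / 3 by lra.
pose i := Num.truncn (r / 3)^-1.
have ir3 : i.+1%:R^-1 < r / 3.
  rewrite -[X in _ < X]invrK ltf_pV2 ?posrE ?invr_gt0 ?ltr0n//.
  exact: truncnS_gt.
have [kappa kappa0 Hk] := HE j i.
(* Beyond [M], the sum contains the term of index [j], and [m] times that term stays below 4, which
   forces the term below r / 3. *)
pose M := maxn j.+1 (Num.truncn (4 / (r / 3))).+1.
have [m [Mm h1 h2]] := near_xy M _ kappa0.
have [K1 K2 Hm] := Hxy m.
have [_ E1] : X' (xy m).1 /\ ~ E (xy m).1 by have [[]] := KE _ K1.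
have [_ E2] : X' (xy m).2 /\ ~ E (xy m).2 by have [[]] := KE _ K2.
have d1 := lt_trans (Hk _ _ Ex E1 h1) ir3.
have d2 := lt_trans (Hk _ _ Ey E2 h2) ir3.
have jm : (j < m)%N by apply: leq_trans Mm; exact: leq_maxl.
have mbig : 4 / (r / 3) < m%:R.
  apply: lt_le_trans (truncnS_gt _) _; rewrite ler_nat; apply: leq_trans Mm.
  exact: leq_maxr.
have d3 : rho (iter j T (xy m).1) (iter j T (xy m).2) < r / 3.
  set z := rho _ _.
  have zs : z <= \sum_(i < m) rho (iter i T (xy m).1) (iter i T (xy m).2).
    by rewrite (bigD1 (Ordinal jm))//= lerDl sumr_ge0.
  have b4 : `|g (xy m).1 - g (xy m).2| <= 4.
    have := ler_normB (g (xy m).1) (g (xy m).2).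
    have := gle (xy m).1; have := gle (xy m).2; lra.
  have z0 : 0 <= z by exact: r0.
  have m4 : m%:R * z < 4.
    have : m%:R * z <= m%:R * \sum_(i < m) rho (iter i T (xy m).1) (iter i T (xy m).2).
      by rewrite ler_wpM2l.
    lra.
  have : 4 < m%:R * (r / 3) by rewrite -ltr_pdivrMr.
  have m0 : 0 < m%:R :> R by rewrite ltr0n (leq_ltn_trans _ jm).
  by move=> h; rewrite -(ltr_pM2l m0); lra.
have := rt (iter j T x) (iter j T (xy m).1) (iter j T y).
have := rt (iter j T (xy m).1) (iter j T (xy m).2) (iter j T y).
rewrite -/r (rs (iter j T (xy m).2)). lra.
Qed.

End entropy_comparison.

Section sums.
Set Implicit Arguments.
Unset Strict Implicit.

Lemma sum_blocks_le {R : realType} (a : nat -> R) (c : R) (p n : nat) :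
  (forall b, (b < p)%N -> \sum_(j < n) a (b * n + j)%N <= c) ->
  \sum_(l < p * n) a l <= p%:R * c.
Proof.
elim: p => [|p IH] H; first by rewrite mul0n big_ord0 mul0r.
rewrite mulSnr big_split_ord/= -natr1 mulrDl mul1r lerD ?H//.
by apply: IH => b bp; apply: H; exact: ltnW.
Qed.

(** Each shift of the window stays within m + N indices. The last N of them fall outside the
    controlled range, where only the majorant [h] is available. *)
Lemma double_sum_le {R : realType} (a h : nat -> R) (m N : nat) :
  (forall l, 0 <= a l) -> (forall l, a l <= h l) ->
  \sum_(j < m) \sum_(i < N) a (i + j)%N <=
  N%:R * (\sum_(l < m) a l + \sum_(l < N) h (m + l)%N).
Proof.
move=> a0 ah; rewrite exchange_big/=.
apply: (@le_trans _ _ (\sum_(i < N) (\sum_(l < m) a l + \sum_(l < N) h (m + l)%N))).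
  apply: ler_sum => i _.
  apply: (@le_trans _ _ (\sum_(l < m + N) a l)); last first.
    by rewrite big_split_ord/= lerD2l; exact: ler_sum.
  have s0 n (f : nat -> nat) : 0 <= \sum_(j < n) a (f j) by exact: sumr_ge0.
  have -> : (m + N = i + m + (N - i))%N by rewrite addnAC (subnKC (ltnW (ltn_ord i))) addnC.
  rewrite !big_split_ord/=; have := s0 i id; have := s0 (N - i)%N (addn (i + m)).
  set a1 := \sum_(_ < i) _; set a2 := \sum_(_ < m) _; set a3 := \sum_(_ < _) _.
  by rewrite /=; lra.
by rewrite sumr_const card_ord mulr_natl.
Qed.

End sums.

Section code_construction.
Set Implicit Arguments.
Unset Strict Implicit.
Context {R : realType} {d : measure_display} {X : measurableType d}.
Context (mu : probability X R) (T : X -> X) (pT : preserving mu T).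
Context (g : X -> R) (X1 : set X) (cg : coordinate mu g X1).

(** The decomposition is read at the start of [p] consecutive blocks, and each resulting class is
    represented by the orbit of one of its good points. The second comparison turns small [rho]
    along the orbits into small differences of coordinates. *)
Lemma decomposable_coded (rho : X -> X -> R) (x0 : X) :
  measurable_semimetric rho ->
  (\int[mu]_x (rho x x0)%:E < +oo)%E ->
  (forall e : R, 0 < e -> exists (N : nat) L u, [/\ 0 <= L, int_le mu u e &
    forall a b, `|g a - g b| <=
      e + L * (\sum_(i < N) rho (iter i T a) (iter i T b)) + u a + u b]) ->
  forall e : R, 0 < e -> exists (p : nat) (delta : R), [/\ (0 < p)%N, 0 < delta &
    forall n k, (0 < n)%N -> decomposable mu (averaged T rho n) delta k ->
      coded mu T g (p * n) e (k ^ p)].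
Proof.
move=> [r0 rs rt mr] ioo G e e0.
have [_ _ mg [gle _] _] := cg.
pose h x := rho x x0.
have [a [a0 hI]] : exists a : R, 0 <= a /\ int_le mu h a.
  have h0 : (0 <= \int[mu]_x (h x)%:E)%E.
    by apply: integral_ge0 => x _; rewrite lee_fin; exact: r0.
  exists (fine (\int[mu]_x (h x)%:E)); split; first exact: fine_ge0.
  split; [exact: measurable_section|by move=> x; exact: r0|].
  by rewrite fineK// ge0_fin_numE.
have e10 : 0 < Order.min (e / 8) (e * e / 256).
  by rewrite lt_min; apply/andP; split; rewrite divr_gt0// mulr_gt0.
set e1 := Order.min _ _ in e10; have [N [L [u [L0 uI H]]]] := G _ e10.
have e1a : e1 <= e / 8 by rewrite ge_min lexx.
have e1b : e1 <= e * e / 256 by rewrite ge_min lexx orbT.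
(* [B] bounds the integral of the boundary part of [w] whatever the length; [p] blocks suffice to
   bring it below [m * e1]. *)
pose B := L * N%:R * (N%:R * a).
have LN0 : 0 <= L * N%:R by rewrite mulr_ge0.
have B0 : 0 <= B by rewrite !mulr_ge0.
pose p := (Num.truncn (B / e1)).+1.
have pB : B <= p%:R * e1.
  by rewrite -ler_pdivrMr// ltW// truncnS_gt.
have D0 : 0 < 8 * (L * N%:R + 4 * p%:R + 1).
  by rewrite mulr_gt0// ltr_wpDl// addr_ge0// mulr_ge0.
(* Chosen to pay at once for the distance along orbits, L N delta, and for an error of 4 per letter
   on the set [Z0] of measure at most p delta. *)
pose delta := e / (8 * (L * N%:R + 4 * p%:R + 1)).
have delta0 : 0 < delta by rewrite divr_gt0.
have deltaE : L * N%:R * delta + 4 * (p%:R * delta) + delta = e / 8.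
  move: D0; rewrite pmulr_rgt0// => /lt0r_neq0 nz.
  by rewrite /delta; field.
exists p, delta; split => // n k n0 /[dup] -[k0 _] /decomposable_code[c [Z [mc mZ Zd cZ]]].
set m := (p * n)%N.
have m0 : (0 < m)%N by rewrite muln_gt0.
have mR : 0 < m%:R :> R by rewrite ltr0n.
have nR : 0 < n%:R :> R by rewrite ltr0n.
have pm : p%:R <= m%:R :> R by rewrite ler_nat leq_pmulr.
pose w x := \sum_(j < m) u (iter j T x) +
  L * N%:R * (\sum_(l < N) h (iter (m + l) T x)).
have wI : int_le mu w ((m%:R * (e / 8)) * (e / 16)).
  apply: (@int_leW _ _ _ _ _ (m%:R * e1 + L * N%:R * (N%:R * a))).
    rewrite -/B.
    have : B <= m%:R * e1 by apply: le_trans pB _; rewrite ler_wpM2r// ltW.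
    have : m%:R * e1 <= m%:R * (e * e / 256) by rewrite ler_wpM2l.
    have -> : m%:R * (e / 8) * (e / 16) = 2 * (m%:R * (e * e / 256)) by field.
    lra.
  apply: int_leD.
    apply: (@int_le_sum _ _ _ _ (fun j x => u (iter j T x))) => j _.
    exact: (int_le_preserving (preserving_iter j pT)).
  apply: int_leZ => //.
  apply: (@int_le_sum _ _ _ _ (fun l x => h (iter (m + l) T x))) => l _.
  exact: (int_le_preserving (preserving_iter (m + l) pT)).
have me0 : 0 < m%:R * (e / 8) by rewrite mulr_gt0// divr_gt0.
have [mW We] := int_le_markov me0 wI.
set W := [set x | _] in mW We.
pose Z0 := \bigcup_(b in [set b | (b < p)%N]) (iter (b * n) T @^-1` Z).
have mpre b : measurable (iter b T @^-1` Z).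
  rewrite -[X in measurable X]setTI.
  by have [mi _] := preserving_iter b pT; exact: (mi measurableT _ mZ).
have mZ0 : measurable Z0 by apply: bigcup_measurable => b _.
have Z0e : (mu Z0 <= (p%:R * delta)%:E)%E.
  apply: measure_bigcup_ord_le => b _ //.
  by have [_ pi] := preserving_iter (b * n) pT; rewrite pi//; exact: ltW.
(* Off [Z0] equal codes force a small total rho-distance along the orbit; off
   [W] the error terms u and the N boundary terms, bounded by h, are small. *)
pose Bad := W `|` Z0.
have mBad : measurable Bad by exact: measurableU.
have BadI : int_le mu (\1_Bad) (e / 16 + p%:R * delta).
  apply: int_le_indic => //; apply: le_trans (measureU2 _ _ _) _ => //.
  by rewrite EFinD leeD.
pose C x := [ffun b : 'I_p => c (iter (b * n) T x)].
have mC : measurable_code C.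
  apply: measurable_code_ffun => b i; rewrite -[X in measurable X]setTI.
  by have [mi _] := preserving_iter (b * n) pT; exact: (mi measurableT _ (mc i)).
pose alpha := e1 + L * N%:R * delta + 2 * (e / 8).
have close x z : ~ Bad x -> ~ Bad z -> C x = C z ->
    \sum_(j < m) `|g (iter j T x) - g (iter j T z)| <= m%:R * alpha.
  move=> /not_orP[/negP + Zx] /not_orP[/negP + Zz] Cxz.
  rewrite -!ltNge => wx wz.
  pose rr l := rho (iter l T x) (iter l T z).
  pose hh l := h (iter l T x) + h (iter l T z).
  have rrh l : rr l <= hh l.
    by apply: le_trans (rt _ x0 _) _; rewrite (rs x0).
  (* Equal codes put both points in the same class at the start of each block, so each block
     contributes at most n delta. *)
  have rrm : \sum_(l < m) rr l <= m%:R * delta.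
    rewrite natrM -mulrA; apply: sum_blocks_le => b bp.
    have Zbx : ~ Z (iter (b * n) T x) by move=> ?; apply: Zx; exists b.
    have Zbz : ~ Z (iter (b * n) T z) by move=> ?; apply: Zz; exists b.
    have := congr1 (fun v : {ffun 'I_p -> 'I_k} => v (Ordinal bp)) Cxz.
    rewrite !ffunE/= => /(cZ _ _ Zbx Zbz)/ltW.
    rewrite /averaged ler_pdivrMl//; apply: le_trans.
    by apply: ler_sum => j _; rewrite /rr addnC !iterD.
  apply: (@le_trans _ _ (\sum_(j < m) (e1 + L * (\sum_(i < N) rr (i + j)%N) +
      u (iter j T x) + u (iter j T z)))).
    apply: ler_sum => j _; apply: le_trans (H _ _) _.
    by under eq_bigr do rewrite -!iterD.
  rewrite !big_split/= sumr_const card_ord -[e1 *+ m]mulr_natl -mulr_sumr.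
  have := double_sum_le m N (fun l => r0 _ _) rrh.
  move=> /(ler_wpM2l L0).
  have -> : \sum_(l < N) hh (m + l)%N =
    \sum_(l < N) h (iter (m + l) T x) + \sum_(l < N) h (iter (m + l) T z).
    by rewrite -big_split.
  have := ler_wpM2l LN0 rrm.
  move: wx wz; rewrite /w /alpha.
  set A1 := \sum_(j < m) u (iter j T x); set A2 := \sum_(j < m) u (iter j T z).
  set B1 := \sum_(j < N) h (iter (m + j) T x).
  set B2 := \sum_(j < N) h (iter (m + j) T z).
  set Q := \sum_(l < m) rr l; set DS := \sum_(j < m) _.
  by rewrite mulrA !mulrDr; lra.
have alpha0 : 0 <= alpha.
  by rewrite /alpha; have := mulr_ge0 LN0 (ltW delta0); lra.
(* The word of a class is the orbit of a point off [Bad], or zero if there is none. Its letters are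
   bounded by 2 in both cases, so on [Bad] the error is at most 4 per letter. *)
have /choice[q Hq] : forall v : {ffun 'I_p -> 'I_k}, exists q : nat -> R,
    (forall j, `|q j| <= 2) /\ forall x, ~ Bad x -> C x = v ->
    \sum_(j < m) `|g (iter j T x) - q j| <= m%:R * alpha.
  move=> v; have [[z [Bz Cz]]|nz] := pselect (exists z, ~ Bad z /\ C z = v).
    exists (fun j => g (iter j T z)); split => // x Bx Cx.
    by apply: close => //; rewrite Cx.
  exists (fun=> 0); split; first by move=> j; rewrite normr0.
  by move=> x Bx Cx; case: nz; exists x.
split; first by rewrite expn_gt0 k0.
exists {ffun 'I_p -> 'I_k}, C, q; split => //; first by rewrite card_ffun !card_ord.
apply: (@int_le_fun _ _ _ _ _ (fun x => m%:R * alpha + m%:R * 4 * \1_Bad x)).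
- exact: (coded_measurable pT mg).
- by move=> x; exact: sumr_ge0.
- move=> x; have [q2 qx] := Hq (C x).
  have [Bx|Bx] := pselect (Bad x); last first.
    by rewrite indicE memNset// mulr0 addr0; exact: qx.
  rewrite indicE mem_set// mulr1 -[leLHS]add0r; apply: lerD; first by rewrite mulr_ge0.
  apply: (@le_trans _ _ (\sum_(j < m) 4)); last first.
    by rewrite sumr_const card_ord mulr_natl.
  apply: ler_sum => j _.
  have := ler_normB (g (iter j T x)) (q (C x) j).
  have := gle (iter j T x); have := q2 j; lra.
(* The parts add up to at most 3e/4 per letter: 3e/8 from [e1] and the Markov threshold, e/4 from
   [W], and e/8 from [delta]. *)
apply: (@int_leW _ _ _ _ _ (m%:R * alpha + m%:R * 4 * (e / 16 + p%:R * delta))).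
  rewrite -mulrA -mulrDr ler_pM2l// /alpha; lra.
apply: int_leD; last by apply: int_leZ => //; rewrite mulr_ge0.
by apply: int_le_cst; rewrite mulr_ge0.
Qed.

End code_construction.

(** * The semimetric given by the coordinate *)

Section coordinate_semimetric.
Set Implicit Arguments.
Unset Strict Implicit.
Context {R : realType} {d : measure_display} {X : measurableType d}.
Context (mu : probability X R) (T : X -> X).
Context (g : X -> R) (X1 : set X) (cg : coordinate mu g X1).

Let rho0 (x y : X) : R := `|g x - g y|.

Let mrho0 : measurable_fun setT (fun z : X * X => rho0 z.1 z.2).
Proof.
have [_ _ mg _ _] := cg; apply: measurableT_comp => //.
apply: measurable_funB; apply: measurableT_comp => //.
Qed.

Let rho0_le x y : rho0 x y <= 4.
Proof.
have [_ _ _ [gle _] _] := cg.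
by have := ler_normB (g x) (g y); have := gle x; have := gle y; rewrite /rho0; lra.
Qed.

Lemma coordinate_semimetric_decomposable (e : R) : 0 < e ->
  exists k, decomposable mu rho0 e k.
Proof.
move=> e0; have [_ _ mg [gle _] _] := cg.
have e2 : 0 < e / 2 by lra.
(* Rescaled so that equal integer parts mean a common cell of length e / 2 in [-2, 2]. *)
pose f x := (g x + 2) / (e / 2).
have f0 x : 0 <= f x.
  rewrite divr_ge0 ?(ltW e2)//.
  by have := gle x; rewrite ler_norml => /andP[]; lra.
pose n := Num.truncn (4 / (e / 2)).
pose c x : 'I_n.+1 := inord (Num.truncn (f x)).
have cE x : c x = Num.truncn (f x) :> nat.
  rewrite inordK// ltnS; apply: le_truncn; rewrite ler_pM2r ?invr_gt0//.
  by have := gle x; rewrite ler_norml => /andP[]; lra.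
exists #|'I_n.+1|.
apply: (@code_decomposable _ _ _ _ _ _ (e / 2) _ c set0).
- by rewrite card_ord.
- move=> i.
  rewrite (_ : _ @^-1` _ = f @^-1` `[i%:R, i.+1%:R[).
    apply: measurable_preimage_fun; last exact: measurable_itv.
    by apply: measurable_funM => //; exact: measurable_funD.
  apply/seteqP; split => x /=; rewrite in_itv/= -truncn_eq//.
    by move=> <-; rewrite cE.
  by move=> /eqP fi; apply: val_inj; rewrite /= cE.
- exact: measurable0.
- by rewrite measure0.
- lra.
move=> x y _ _ /(congr1 val)/=; rewrite !cE => fxy.
have /andP[x1 x2] := truncn_itv (f0 x); have /andP[y1 y2] := truncn_itv (f0 y).
rewrite fxy in x1 x2.
have fd : `|f x - f y| <= 1.
  by move: x2 y2; rewrite -!natr1 ler_norml => x2 y2; apply/andP; split; lra.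
have -> : rho0 x y = `|f x - f y| * (e / 2).
  rewrite /rho0 -[X in _ = _ * X](gtr0_norm e2) -normrM; congr (`|_|); rewrite /f; field.
  exact: lt0r_neq0.
by rewrite -[leRHS]mul1r ler_wpM2r// ltW.
Qed.

(** This shows that admissible generating integrable semimetrics exist, and it is also the source of
    finite codes for every error. The average of length 1 already separates the points of [X1]. *)
Lemma coordinate_scaling_semimetric : scaling_semimetric mu T rho0.
Proof.
have [mX1 X11 mg [gle injg] _] := cg; split.
- split => //.
  + by move=> x y; rewrite /rho0 normr_ge0.
  + by move=> x y; rewrite /rho0 distrC.
  + by move=> x y z; exact: ler_distD.
- move=> e /coordinate_semimetric_decomposable[k dk].
  by apply: le_lt_trans (eps_entropy_le dk) _; rewrite ltry.
- exists X1; split => // x y X1x X1y xy; exists 1%N; split => //.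
  rewrite /averaged big_ord1 invr1 mul1r/= /rho0 normr_gt0 subr_eq0.
  by apply/eqP => gxy; apply: xy; apply: injg; rewrite ?inE.
- apply: (@le_lt_trans _ _ (\int[(mu \x mu)%E]_z (cst 4%:E z))%E).
    apply: ge0_le_integral => //=.
    + by move=> z _; rewrite lee_fin normr_ge0.
    + exact/measurable_EFinP.
    + by move=> z _; rewrite lee_fin; exact: rho0_le.
  have mm : ((mu \x mu)%E [set: X * X] = 1)%E.
    have := product_measure1E mu mu (@measurableT _ X) (@measurableT _ X).
    rewrite setXTT => ->.
    by rewrite [X in (X * _)%E](@probability_setT _ _ _ mu) mul1e; exact: probability_setT.
  by rewrite integral_cst// [X in (_ * X)%E]mm mule1 ltry.
Qed.

End coordinate_semimetric.

(** * The subadditive representative *)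

Section scaling_function.
Set Implicit Arguments.
Unset Strict Implicit.
Context {R : realType} {d : measure_display} {X : measurableType d}.
Context (mu : probability X R) (T : X -> X) (g : X -> R).

Definition window_coded (n : nat) (e : R) (k : nat) : Prop :=
  exists2 m, (n <= m)%N & coded mu T g m e k.

(* The infimum over m >= n makes the function increasing. The value 0 is junk,
   never taken when 0 < e and g is a coordinate. *)
Definition window_entropy (n : nat) (e : R) : R :=
  match pselect (exists k : nat, `[< window_coded n e k >]) with
  | left ex_k => ln (ex_minn ex_k)%:R / ln 2
  | right _ => 0
  end.

Lemma window_entropy_le n e k : window_coded n e k ->
  window_entropy n e <= ln k%:R / ln 2.
Proof.
move=> wk; rewrite /window_entropy; case: pselect => [ex|/(_ _)[]]; last first.
  by exists k; apply/asboolP.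
case: ex_minnP => m /asboolP[l _ [m0 _]] mk; apply: log2_nat_le => //.
by apply: mk; apply/asboolP.
Qed.

Lemma window_entropy_min n e : (exists k, window_coded n e k) ->
  exists2 k, window_coded n e k & window_entropy n e = ln k%:R / ln 2.
Proof.
move=> [k wk]; rewrite /window_entropy; case: pselect => [ex|/(_ _)[]]; last first.
  by exists k; apply/asboolP.
by case: ex_minnP => m /asboolP wm _; exists m.
Qed.

End scaling_function.

Theorem theorem2 (R : realType) (d : measure_display) (X : measurableType d)
    (mu : probability X R) (T : X -> X)
    (standard_X : standard_probability mu)
    (T_mp : invertible_measure_preserving mu T) :
  exists Phi : nat -> R -> R,
    [/\ forall n eps, (0 < n)%N -> 0 < eps -> 0 <= Phi n eps,
        forall n m eps, (0 < n)%N -> (n <= m)%N -> 0 < eps ->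
          Phi n eps <= Phi m eps,
        forall n eps1 eps2, (0 < n)%N -> 0 < eps1 -> eps1 <= eps2 ->
          Phi n eps2 <= Phi n eps1,
        forall k m eps, (0 < k)%N -> (0 < m)%N -> 0 < eps ->
          Phi (k + m)%N eps <= Phi k eps + Phi m eps &
        scaling_entropy mu T Phi].
Proof.
have [g [X1 cg]] := standard_coordinate standard_X.
have [mT [S [TS ST mS]] pT'] := T_mp.
have pT : preserving mu T by split.
have [_ _ mg _ _] := cg.
have lower rho : scaling_semimetric mu T rho -> forall e : R, 0 < e ->
    exists (p : nat) (delta : R), [/\ (0 < p)%N, 0 < delta &
    forall n k, (0 < n)%N -> decomposable mu (averaged T rho n) delta k ->
      coded mu T g (p * n) e (k ^ p)].
  move=> [rho_sm rho_adm rho_gen rho_int].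
  have [x0 x0_int] := integrable_section rho_sm rho_int.
  apply: (decomposable_coded pT cg rho_sm x0_int).
  apply: (coordinate_le_semimetric pT cg rho_sm _ rho_gen).
  exact: admissible_decomposable.
have upper rho : scaling_semimetric mu T rho -> forall e : R, 0 < e ->
    exists2 delta : R, 0 < delta & forall n k, (0 < n)%N ->
      coded mu T g n delta k -> decomposable mu (averaged T rho n) e k.
  move=> [rho_sm rho_adm _ rho_int].
  have [x0 x0_int] := integrable_section rho_sm rho_int.
  apply: (coded_decomposable pT).
  apply: (semimetric_le_coordinate cg rho_sm _ x0_int).
  exact: admissible_decomposable.
have rho0P := coordinate_scaling_semimetric T cg.
(* For the coordinate semimetric the average of length 1 is the semimetric itself, so some length
   [p] can be coded; repeating that code n + 1 times reaches length at least n. *)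
have ex n e : 0 < e -> exists k, window_coded mu T g n e k.
  move=> e0; have [p [delta [p0 delta0 H]]] := lower _ rho0P _ e0.
  have [k dk] := coordinate_semimetric_decomposable cg delta0.
  have /coded_power : coded mu T g (p * 1) e (k ^ p).
    apply: H => //; rewrite [averaged _ _ _](_ : _ = fun x y => `|g x - g y|)//.
    by apply/funext => x; apply/funext => y; rewrite /averaged big_ord1 invr1 mul1r.
  move=> /(_ pT n)[k' ck']; exists k', (n.+1 * (p * 1))%N => //.
  by rewrite muln1 (leq_trans (leqnSn n))// leq_pmulr.
have ln2_gt0 : 0 < ln 2 :> R by rewrite ln_gt0// ltr1n.
have Phi_ge0 n e : 0 < e -> 0 <= window_entropy mu T g n e.
  move=> /(ex n)/window_entropy_min[k [m _ [k0 _]] ->].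
  by rewrite divr_ge0 ?(ltW ln2_gt0)// ln_ge0// ler1n.
have Phi_anti n e1 e2 : 0 < e1 -> e1 <= e2 ->
    window_entropy mu T g n e2 <= window_entropy mu T g n e1.
  move=> /(ex n)/window_entropy_min[k [m nm cm] ->] e12.
  by apply: window_entropy_le; exists m => //; exact: coded_le cm.
exists (window_entropy mu T g); split.
- by move=> n e _; exact: Phi_ge0.
- move=> n m e _ nm /(ex m)/window_entropy_min[k [l ml cl] ->].
  by apply: window_entropy_le; exists l => //; exact: leq_trans ml.
- by move=> n e1 e2 _; exact: Phi_anti.
(* Concatenating two optimal codes multiplies their sizes, and the logarithm turns the product into
   a sum. *)
- move=> a b e _ _ e0.
  have [k [m am cm] ->] := window_entropy_min (ex a _ e0).
  have [k' [m' bm' cm'] ->] := window_entropy_min (ex b _ e0).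
  have [[k0 _] [k'0 _]] := (cm, cm').
  rewrite -mulrDl -lnM ?posrE ?ltr0n// -natrM; apply: window_entropy_le.
  by exists (m + m')%N; [exact: leq_add|exact: coded_cat].
split; first by move=> n e _; exact: Phi_ge0.
split; first by move=> n e1 e2 _; exact: Phi_anti.
split; first by exists (fun x y => `|g x - g y|).
move=> rho rhoP; split => e e0.
(* A decomposition into k pieces gives a code of size k^p for the length p n >= n, whence the
   constant [p], uniform in n. *)
- have [p [delta [p0 delta0 H]]] := lower _ rhoP _ e0.
  exists delta; split => //; exists p%:R; split => [|n n0]; first by rewrite ltr0n.
  have [fin|] := ltP (eps_entropy mu (averaged T rho n) delta) +oo%E; last first.
    by rewrite leye_eq => /eqP ->; rewrite gt0_muley ?leey// lte_fin ltr0n.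
  have [k dk ->] := eps_entropy_fin fin; have [k0 _] := dk.
  rewrite -EFinM lee_fin mulrA mulr_natl -lnXn ?ltr0n// -natrX.
  by apply: window_entropy_le; exists (p * n)%N; [exact: leq_pmull|exact: H].
- have [delta delta0 H] := upper _ rhoP _ e0.
  (* An optimal code may have any length m >= n; restricting it to length n doubles the error. *)
  have d2 : 0 < delta / 2 by rewrite divr_gt0.
  exists (delta / 2); split => //; exists 1; split => // n n0.
  have [k [m nm cm] ->] := window_entropy_min (ex n _ d2).
  rewrite mul1e; apply: eps_entropy_le; apply: H => //.
  have -> : delta = 2 * (delta / 2) by rewrite mulrCA divff ?mulr1.
  exact: (coded_restrict TS pT mS mg n0 nm (ltW d2)).
Qed.
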